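(* Let $T$ be an expanding rational map of degree at least $2$ of the Riemann sphere $\overline{\mathbb C}$, let $J(T)$ be its Julia set, $\delta=\dim J(T)$, and fix $z_0\in J(T)$. Let $$\mathrm{Bad}_{z_0}(J)=\{z\in J(T):\ \exists c(z)>0 \text{ such that } T^n(z)\notin B(z_0,c(z)) \text{ for all } n\in\mathbb N\}.$$ Then $\dim\mathrm{Bad}_{z_0}(J)=\delta$.
   Context: $\dim$ is Hausdorff dimension, with respect to the spherical metric on $\overline{\mathbb C}$ (balls $B(z_0,r)$ are taken in this metric). $T$ is expanding if there exist $C>0$ and $\lambda>1$ such that $|(T^n)'(z)|\ge C\lambda^n$ for all $z\in J(T)$ and $n\ge1$ (derivative with respect to the spherical metric). *)

(* Defs.v *)
From HB Require Import structures.
From mathcomp Require Import all_boot all_order all_algebra.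
From mathcomp Require Import all_classical all_reals all_analysis.
From mathcomp Require Import complex.
Set Implicit Arguments. Unset Strict Implicit. Unset Printing Implicit Defensive.
Import Order.TTheory GRing.Theory Num.Theory.
Local Open Scope classical_set_scope.
Local Open Scope ring_scope.

Section RiemannSphere.
Variable R : realType.
Local Notation C := (R[i]).

(** The Riemann sphere: [Some z] is the finite point z, [None] is infinity. *)
Definition sphere := option C.

Definition cabs2 (z : C) : R := complex.Re z ^+ 2 + complex.Im z ^+ 2.

Definition sdist (x y : sphere) : R :=
  match x, y with
  | Some z, Some w => 2 * Num.sqrt (cabs2 (z - w)) /
                        Num.sqrt ((1 + cabs2 z) * (1 + cabs2 w))
  | Some z, None | None, Some z => 2 / Num.sqrt (1 + cabs2 z)
  | None, None => 0
  end.

(** Rational maps p/q with p, q coprime, acting on the sphere. *)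
Definition degp (p : {poly C}) : nat := (size p).-1.

Definition rat_degree (p q : {poly C}) : nat := maxn (degp p) (degp q).

Definition rat_map (p q : {poly C}) (x : sphere) : sphere :=
  match x with
  | Some z => if q.[z] != 0 then Some (p.[z] / q.[z]) else None
  | None =>
      if (degp p > degp q)%N then None
      else if degp p == degp q then Some (lead_coef p / lead_coef q)
      else Some 0
  end.

Definition iterate (f : sphere -> sphere) (n : nat) : sphere -> sphere :=
  iter n f.

Definition fatou (f : sphere -> sphere) (x : sphere) : Prop :=
  exists2 r : R, 0 < r & forall w, sdist x w < r ->
    forall e : R, 0 < e -> exists2 eta : R, 0 < eta &
      forall (n : nat) (y : sphere), sdist w y < eta ->
        sdist (iterate f n w) (iterate f n y) < e.

Definition julia (f : sphere -> sphere) : set sphere := ~` [set x | fatou f x].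

Definition sph_deriv_norm (g : sphere -> sphere) (x : sphere) (L : R) : Prop :=
  forall e : R, 0 < e -> exists2 eta : R, 0 < eta &
    forall y, y <> x -> sdist y x < eta ->
      `| sdist (g y) (g x) / sdist y x - L | < e.

Definition expanding (f : sphere -> sphere) : Prop :=
  exists C0 : R, exists lam : R, [/\ 0 < C0, 1 < lam &
    forall (n : nat) (x : sphere), (1 <= n)%N -> julia f x ->
      exists L : R, sph_deriv_norm (iterate f n) x L /\ C0 * lam ^+ n <= L].

Definition sdiam (U : set sphere) : R :=
  sup [set sdist x y | x in U & y in U].

Definition hausdorff_measure (s : R) (A : set sphere) : \bar R :=
  ereal_sup [set ereal_inf
     [set (\sum_(0 <= i <oo) ((sdiam (U i)) `^ s)%:E)%E
       | U in [set U : nat -> set sphere |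
                A `<=` \bigcup_i U i /\ forall i, sdiam (U i) <= d]]
   | d in [set d : R | 0 < d]].

Definition hausdorff_dim (A : set sphere) : \bar R :=
  ereal_inf [set s%:E | s in [set s : R | 0 <= s /\ hausdorff_measure s A = 0%E]].

Definition sball (x0 : sphere) (c : R) : set sphere := [set y | sdist x0 y < c].

Definition bad_set (f : sphere -> sphere) (z0 : sphere) : set sphere :=
  [set z | julia f z /\ exists2 c : R, 0 < c &
             forall n : nat, ~ sball z0 c (iterate f n z)].

End RiemannSphere.

(* Main.v *)
Require Import Defs.
From HB Require Import structures.
From mathcomp Require Import all_boot all_order all_algebra.
From mathcomp Require Import all_classical all_reals all_analysis.
From mathcomp Require Import complex ring lra.
Set Implicit Arguments. Unset Strict Implicit. Unset Printing Implicit Defensive.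
Import Order.TTheory GRing.Theory Num.Theory.
Import numFieldNormedType.Exports.
Import Normc.
Local Open Scope classical_set_scope.
Local Open Scope ring_scope.

(** Only [dim J <= dim Bad] needs work. Let [S = T^N] expand [J] by a factor at
least 8. Inverse branches of [S^n] at points of [J] are defined on balls of a
fixed radius with bounded distortion. If the branches [u] returning a ball to
itself have, for some [n], total weight [sum_u |(S^n)'(u)|^-s] above
[1 + n N], delete the at most [n N] of them whose image contains some
[T^k z0], [1 <= k <= n N]. The limit set of the remaining branches is
[S^n]-invariant and its orbit stays away from [z0], because [T^j z = z0] with
[0 <= j < n N] would force [S^n z = T^(nN - j) z0] into a deleted image. So it
lies in [Bad], and since its remaining weight is at least 1 it is not
[H^s]-null: in any cover of too small total weight one can always descend to a
branch on which the rescaled cover still is too small, and no covering set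
survives in the limit. Hence, if [Bad] is [H^s]-null, the weights grow at most
linearly in [n]; the branches then cover the points returning infinitely often
to a given ball with arbitrarily small [s']-sums for [s' > s], and countably
many preimages of finitely many such sets exhaust [J].

The local geometry of [T] comes from homogeneous coordinates: if [F = (P, Q)]
lifts [T] to C^2, then [F u /\ F v = (u /\ v) H(u, v)] for a polynomial [H],
so that [d(Tx, Ty) = T'(x) d(x, y) + O(d(x, y)^2)] uniformly on the sphere, and
openness of [T] follows by factoring the binary forms [F u /\ w]. *)

(** * Real estimates *)

Lemma count_le1 (T : eqType) (P : pred T) (L : seq T) : uniq L ->
  (forall u v, u \in L -> v \in L -> P u -> P v -> u = v) -> (count P L <= 1)%N.
Proof.
move=> uL uv; rewrite leqNgt -size_filter; apply/negP.
have := filter_uniq P uL.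
have hP u : u \in [seq x <- L | P x] -> P u /\ u \in L by rewrite mem_filter => /andP.
case: [seq x <- L | P x] hP => [|u [|v L']]// hP /= /andP[+ _] _.
have [|Pu uL'] := hP u; first by rewrite inE eqxx.
have [|Pv vL'] := hP v; first by rewrite !inE eqxx orbT.
by rewrite (uv u v)// inE eqxx.
Qed.

Section Reals.
Variable R : realType.
Implicit Types (e t K s : R) (w : nat -> R).

Lemma geometric_small t e : 0 <= t -> t < 1 -> 0 < e -> exists m, t ^+ m < e.
Proof.
move=> t0 t1 e0.
have /cvgrPdist_lt/(_ e e0)[m _ /(_ m (leqnn m))] :
    (fun n => t ^+ n) @ \oo --> (0 : R) by apply: cvg_expr; rewrite ger0_norm.
by rewrite sub0r normrN ger0_norm ?exprn_ge0// => ?; exists m.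
Qed.

Lemma ler_psum w (P : pred nat) n m : (forall i, 0 <= w i) -> (n <= m)%N ->
  \sum_(0 <= i < n | P i) w i <= \sum_(0 <= i < m | P i) w i.
Proof.
by move=> w0 nm; rewrite [leRHS](@big_cat_nat _ _ _ n)//= lerDl sumr_ge0.
Qed.

Lemma half_sum e n : 0 <= e -> \sum_(0 <= k < n) e / 2 ^+ k.+1 <= e.
Proof.
move=> e0; suff -> : \sum_(0 <= k < n) e / 2 ^+ k.+1 = e * (1 - (2 ^+ n)^-1).
  by rewrite ler_piMr// gerBl invr_ge0 exprn_ge0.
elim: n => [|n IH]; first by rewrite big_nil expr0 invr1 subrr mulr0.
rewrite big_nat_recr//= IH exprS invfM.
by field; rewrite expf_neq0.
Qed.

(** The minimum of finitely many positive gaps serves all indices. It will give one distance to the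
    forbidden points that is valid for all retained branches. *)
Lemma uniform_gap (I : eqType) (L : seq I) (Q : I -> R -> Prop) :
  (forall i c c', c <= c' -> Q i c' -> Q i c) ->
  (forall i, i \in L -> exists2 c, 0 < c & Q i c) ->
  exists2 c, 0 < c & forall i, i \in L -> Q i c.
Proof.
move=> Qle; elim: L => [|i L IH] hL; first by exists 1.
have [|c c0 hc] := IH; first by move=> j jL; apply: hL; rewrite inE jL orbT.
have [|c' c'0 hc'] := hL i; first by rewrite inE eqxx.
exists (Num.min c c'); first by rewrite lt_min c0.
move=> j; rewrite inE => /predU1P[->|/hc hj].
  by apply: Qle hc'; rewrite ge_min lexx orbT.
by apply: Qle hj; rewrite ge_min lexx.
Qed.

(* With [u = sqrt t], Bernoulli's inequality makes [n * u ^+ n] bounded. *)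
Lemma linear_geometric_tail t K e (N : nat) : 0 < t -> t < 1 -> 0 < e -> 0 <= K ->
  exists n0, forall n m, (n0 <= n)%N ->
    \sum_(0 <= k < m) K * t ^+ (n + k) * (1 + ((n + k) * N)%:R) <= e.
Proof.
move=> t0 t1 e0 K0; pose u := Num.sqrt t.
have u0 : 0 < u by rewrite sqrtr_gt0.
have u1 : u < 1 by rewrite -sqrtr1 ltr_sqrt.
have u2 : t = u ^+ 2 by rewrite sqr_sqrtr// ltW.
have b n : u ^+ n * (1 + (n * N)%:R) <= 1 + N%:R / (u^-1 - 1).
  have v0 : 0 < u^-1 - 1 by rewrite subr_gt0 invf_gt1.
  have h : 1 + n%:R * (u^-1 - 1) <= u^-1 ^+ n.
    elim: n => [|n IH]; first by rewrite mul0r addr0.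
    rewrite exprS -natr1; have u1' : 1 <= u^-1 by rewrite ltW// invf_gt1.
    apply: le_trans (ler_wpM2l (le_trans ler01 u1') IH).
    have n0 : 0 <= n%:R :> R by [].
    by have := mulr_ge0 n0 (sqr_ge0 (u^-1 - 1)); lra.
  have un : u ^+ n * u^-1 ^+ n = 1 by rewrite -exprMn divff ?expr1n// gt_eqF.
  have un1 : u ^+ n <= 1 by rewrite exprn_ile1// ltW.
  have un0 : 0 < u ^+ n by rewrite exprn_gt0.
  rewrite mulrDr mulr1 lerD// natrM mulrA (mulrC N%:R) ler_wpM2r//.
  rewrite -div1r ler_pdivlMr// -[leRHS]un -mulrA ler_wpM2l ?(ltW un0)//.
  by apply: le_trans h; rewrite lerDr.
set K1 := 1 + _ in b.
have K10 : 0 < K1.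
  by rewrite ltr_wpDr// divr_ge0// subr_ge0 ltW// invf_gt1.
have [n0 hn0] : exists n0, u ^+ n0 < e * (1 - u) / (K * K1 + 1).
  apply: geometric_small; rewrite ?ltW//.
  by rewrite divr_gt0 ?mulr_gt0 ?subr_gt0// ltr_wpDl// mulr_ge0// ltW.
exists n0 => n m nn.
(* Of the two factors in [t = u ^+ 2], one absorbs the linear weight through [b]; the other leaves a
   geometric series of ratio [u]. *)
have le1 k : K * t ^+ (n + k) * (1 + ((n + k) * N)%:R) <= K * K1 * u ^+ n * u ^+ k.
  rewrite u2 -exprM mulnC exprM expr2 -!mulrA ler_wpM2l// mulrCA [leRHS]mulrC.
  by rewrite -exprD ler_wpM2l// exprn_ge0// ltW.
apply: (@le_trans _ _ (K * K1 * u ^+ n * \sum_(0 <= k < m) u ^+ k)).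
  by rewrite mulr_sumr; apply: ler_sum => k _; apply: le1.
have gs : (1 - u) * \sum_(0 <= k < m) u ^+ k = 1 - u ^+ m.
  elim: (m) => [|j IH]; first by rewrite big_nil mulr0 expr0 subrr.
  by rewrite big_nat_recr//= mulrDr IH exprS; ring.
have {gs}gs : \sum_(0 <= k < m) u ^+ k <= (1 - u)^-1.
  by rewrite -[leRHS]mul1r ler_pdivlMr ?subr_gt0// mulrC gs gerBl exprn_ge0// ltW.
have KK : 0 <= K * K1 by rewrite mulr_ge0// ltW.
apply: le_trans (ler_wpM2l _ gs) _; first by rewrite mulr_ge0// exprn_ge0// ltW.
rewrite ler_pdivrMr ?subr_gt0//.
have {}hn0 : u ^+ n < e * (1 - u) / (K * K1 + 1).
  by apply: le_lt_trans hn0; rewrite ler_wiXn2l// ltW.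
rewrite ltr_pdivlMr ?ltr_wpDl// in hn0.
apply/ltW; apply: le_lt_trans hn0.
by rewrite mulrC ler_wpM2l ?exprn_ge0 ?lerDl// ltW.
Qed.

End Reals.

(** * Small covers *)

Section Covers.
Variables (R : realType) (X : choiceType) (d : X -> X -> R).
Implicit Types (s e : R) (A B : set X).

(* [w i] plays the role of [diam (U i) `^ s]. *)
Definition scover s A e := exists (U : nat -> set X) (w : nat -> R),
  [/\ forall i, 0 <= w i,
      forall i x y, U i x -> U i y -> d x y `^ s <= w i,
      A `<=` \bigcup_i U i &
      forall n, \sum_(0 <= i < n) w i <= e].

Definition snull s A := forall e, 0 < e -> scover s A e.

Lemma scoverW s A B e e' : A `<=` B -> e <= e' -> scover s B e -> scover s A e'.
Proof.
move=> AB ee [U [w [w0 Uw BU we]]]; exists U, w; split => //.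
  exact: subset_trans BU.
by move=> n; apply: le_trans (we n) ee.
Qed.

(** The countably many covers are merged along an enumeration of pairs; since weights are
    nonnegative, a partial sum is bounded by the sum over a square of pairs. *)
Lemma scover_bigcup s (A : nat -> set X) (e : nat -> R) e' :
  (forall k, scover s (A k) (e k)) ->
  (forall n, \sum_(0 <= k < n) e k <= e') -> scover s (\bigcup_k A k) e'.
Proof.
move=> /choice[U /choice[w h]] ee.
have w0 k i : 0 <= w k i by case: (h k).
(* Integers that code no pair get the empty set and weight 0. *)
pose V n : set X := if @pickle_inv (nat * nat)%type n is Some ki then U ki.1 ki.2 else set0.
pose v n : R := if @pickle_inv (nat * nat)%type n is Some ki then w ki.1 ki.2 else 0.
exists V, v; split.
- by move=> n; rewrite /v; case: pickle_inv.
- move=> n x y; rewrite /V /v; case: pickle_inv => [[k i]|]//=.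
  by case: (h k) => _ + _ _; apply.
- move=> x [k _ Akx]; case: (h k) => _ _ /(_ x Akx)[i _ Ux] _.
  by exists (pickle (k, i)) => //; rewrite /V pickleK_inv.
move=> n.
(* All pairs with code below [n] lie in an [N] by [N] square. *)
have [N hN] : exists N, forall m, (m < n)%N ->
    if @pickle_inv (nat * nat)%type m is Some ki then (ki.1 < N)%N && (ki.2 < N)%N else true.
  elim: n => [|n [N hN]]; first by exists 0.
  case E: (@pickle_inv (nat * nat)%type n) => [[k i]|].
    exists (maxn N (maxn k.+1 i.+1)) => m; rewrite ltnS leq_eqVlt => /predU1P[->|/hN].
      by rewrite E/= !leq_max !leqnn !orbT.
    by case: pickle_inv => // -[k' i']/= /andP[k'N i'N]; rewrite !leq_max k'N i'N.
  by exists N => m; rewrite ltnS leq_eqVlt => /predU1P[->|/hN//]; rewrite E.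
apply: le_trans (ee N).
apply: (@le_trans _ _ (\sum_(0 <= k < N) \sum_(0 <= i < N) w k i)); last first.
  by apply: ler_sum => k _; case: (h k).
(* Written as an indicator sum over the square, [v m] allows the sums to be exchanged; each pair is
   then counted at most once. *)
have vE m : (m < n)%N -> v m = \sum_(0 <= k < N) \sum_(0 <= i < N)
    (if pickle (k, i) == m then w k i else 0).
  move=> /hN; rewrite /v; case E: pickle_inv => [[k0 i0]|]; last first.
    move=> _; rewrite big1// => k _; rewrite big1// => i _.
    by case: eqP => // km; move: E; rewrite -km pickleK_inv.
  have := @pickle_invK (nat * nat)%type m; rewrite E/= => pm /andP[k0N i0N].
  rewrite (bigD1_seq k0) ?iota_uniq ?mem_index_iota//=.
  rewrite (bigD1_seq i0) ?iota_uniq ?mem_index_iota//=.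
  rewrite pm eqxx big1 ?addr0; last first.
    move=> i ii; case: eqP => // /esym; rewrite -pm => /(pcan_inj pickleK)[] e1.
    by rewrite e1 eqxx in ii.
  rewrite big1 ?addr0// => k kk; rewrite big1// => i _.
  case: eqP => // /esym; rewrite -pm => /(pcan_inj pickleK)[] e1.
  by rewrite e1 eqxx in kk.
have vE' m : (0 <= m < n)%N -> _ := vE m.
rewrite (eq_big_nat _ _ (F2 := fun m => \sum_(0 <= k < N) \sum_(0 <= i < N)
  (if pickle (k, i) == m then w k i else 0)) vE') exchange_big/=.
apply: ler_sum => k _.
rewrite exchange_big/=; apply: ler_sum => i _.
under eq_bigr do rewrite eq_sym.
by rewrite -big_mkcond/= (big_nat1_eq _ (fun=> w k i)); case: ifP.
Qed.

Lemma snullW s A B : A `<=` B -> snull s B -> snull s A.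
Proof. by move=> AB nB e /nB; apply: scoverW. Qed.

Lemma snull0 s : snull s set0.
Proof.
move=> e e0; exists (fun=> set0), (fun=> 0); split => // n.
by rewrite big1// ltW.
Qed.

Lemma snull_bigcup s (A : nat -> set X) :
  (forall k, snull s (A k)) -> snull s (\bigcup_k A k).
Proof.
move=> nA e e0; apply: (@scover_bigcup _ _ (fun k => e / 2 ^+ k.+1)).
  by move=> k; apply: nA; rewrite divr_gt0// exprn_gt0.
by move=> n; apply: half_sum; apply: ltW.
Qed.

(** The covering sequence lists the finitely many pieces and continues with empty sets of weight
    0. *)
Lemma scover_seq s (I : eqType) (L : seq I) (A : I -> set X) (w : I -> R) :
  (forall u, u \in L -> 0 <= w u) ->
  (forall u x y, u \in L -> A u x -> A u y -> d x y `^ s <= w u) ->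
  scover s [set x | exists2 u, u \in L & A u x] (\sum_(u <- L) w u).
Proof.
case: L => [|u0 L']; last set L := _ :: _.
  move=> _ _; rewrite big_nil; exists (fun=> set0), (fun=> 0); split => //.
    by move=> x [u].
  by move=> n; rewrite big1.
move=> w0 Aw; exists (fun i => [set x | (i < size L)%N /\ A (nth u0 L i) x]).
exists (fun i => if (i < size L)%N then w (nth u0 L i) else 0); split.
- by move=> i; case: ifP => // iL; rewrite w0// mem_nth.
- by move=> i x y [iL Ax] [_ Ay]; rewrite iL; apply: Aw => //; apply: mem_nth.
- move=> x [u uL Ax]; exists (index u L) => //.
  by split; rewrite ?index_mem ?nth_index.
move=> n.
rewrite -big_mkcond/= (big_nth u0).
apply: (@le_trans _ _ (\sum_(0 <= i < n + size L | (i < size L)%N) w (nth u0 L i))).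
  rewrite [leRHS](@big_cat_nat _ _ _ n) ?leq_addr//= lerDl sumr_ge0// => i iL.
  by rewrite w0// mem_nth.
rewrite (@big_cat_nat _ _ _ (size L)) ?leq_addl//= [X in _ + X]big1_seq ?addr0; last first.
  by move=> i; rewrite mem_index_iota => /andP[iL /andP[/leq_trans/(_ iL)]]; rewrite ltnn.
rewrite big_nat_cond [leRHS]big_nat_cond le_eqVlt; apply/orP; left; apply/eqP.
by apply: eq_bigl => i; rewrite leq0n /=; case: (i < size L)%N.
Qed.

End Covers.

(** * Expanding conformal systems *)

Section Repeller.
Variables (R : realType) (X : choiceType) (d : X -> X -> R).
Hypothesis d_ge0 : forall x y, 0 <= d x y.
Hypothesis d_self : forall x, d x x = 0.
Hypothesis d_eq0 : forall x y, d x y = 0 -> x = y.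
Hypothesis d_sym : forall x y, d x y = d y x.
Hypothesis d_tri : forall y x z, d x z <= d x y + d y z.
Hypothesis d_cluster : forall x : nat -> X,
  exists a, forall (e : R) m, 0 < e -> exists2 k, (m <= k)%N & d a (x k) < e.

(** * Closed sets, finite nets and nested intersections in a compact space *)

Definition dclosed (B : set X) :=
  forall a, (forall e, 0 < e -> exists2 y, B y & d a y < e) -> B a.

Lemma dclosed_gap (B : set X) a : dclosed B -> ~ B a ->
  exists2 c, 0 < c & forall y, B y -> c <= d a y.
Proof.
move=> Bcl nBa; apply: contrapT => nc; apply: nBa; apply: Bcl => e e0.
apply: contrapT => ny; apply: nc; exists e => // y By; rewrite leNgt.
by apply/negP => de; apply: ny; exists y.
Qed.

Lemma dclosedI (B C : set X) : dclosed B -> dclosed C -> dclosed (B `&` C).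
Proof.
move=> Bcl Ccl a ha; split; [apply: Bcl|apply: Ccl] => e /ha[y [By Cy] ay];
  by exists y.
Qed.

Lemma dclosed_le (x : X) c : dclosed [set y | d x y <= c].
Proof.
move=> a ha; rewrite /= leNgt; apply/negP => ca.
have /ha[y /= xy ay] : 0 < d x a - c by rewrite subr_gt0.
by have := d_tri y x a; rewrite (d_sym y a); lra.
Qed.

Lemma dclosed_preimage (f : X -> X) L (B : set X) : 0 < L ->
  (forall x y, d (f x) (f y) <= L * d x y) -> dclosed B -> dclosed (f @^-1` B).
Proof.
move=> L0 fL Bcl a ha; apply: Bcl => e e0.
have [|y By ay] := ha (e / L); first by rewrite divr_gt0.
exists (f y) => //; apply: le_lt_trans (fL _ _) _.
by rewrite mulrC -ltr_pdivlMr.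
Qed.

(** Cantor's intersection argument: a cluster point of any choice of points in the [C m] is
    approached from within each of them. *)
Lemma nested_point (C : nat -> set X) : (forall m, dclosed (C m)) ->
  (forall m, C m !=set0) -> (forall m, C m.+1 `<=` C m) -> exists z, forall m, C m z.
Proof.
move=> Ccl /choice[x xC] Cdec; have [a ha] := d_cluster x; exists a => m.
have Cle k : (m <= k)%N -> C k `<=` C m.
  elim: k => [|k IH]; first by rewrite leqn0 => /eqP->.
  by rewrite leq_eqVlt => /predU1P[->//|/IH kC]; apply: subset_trans kC.
by apply: Ccl => e /(ha _ m)[k mk ak]; exists (x k) => //; apply: (Cle k).
Qed.

(** Otherwise a greedy choice never stops and yields a sequence with mutual distances above [e],
    whereas two of its terms lie within [e / 2] of a cluster point. *)
Lemma finite_net (B : set X) e : 0 < e ->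
  exists L : seq X, (forall u, u \in L -> B u) /\
                    forall x, B x -> exists2 u, u \in L & d u x <= e.
Proof.
move=> e0; apply: contrapT => nL.
have nL' (L : seq X) : (forall u, u \in L -> B u) ->
    {x | B x & forall u, u \in L -> e < d u x}.
  move=> LB; apply: cid2; apply: contrapT => nx; apply: nL; exists L; split=> // x Bx.
  apply: contrapT => nu; apply: nx; exists x => // u uL; rewrite ltNge.
  by apply/negP => ux; apply: nu; exists u.
pose T := {L : seq X | forall u, u \in L -> B u}.
have nxt (L : T) : {L' : T | exists2 x, sval L' = x :: sval L &
                              forall u, u \in sval L -> e < d u x}.
  case: L => L LB; have [x Bx Lx] := nL' L LB.
  have LB' u : u \in x :: L -> B u by rewrite inE => /predU1P[->|/LB].
  by exists (exist _ _ LB'), x.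
have nilB u : u \in [::] -> B u by rewrite in_nil.
pose L n := iter n (fun L => sval (nxt L)) (exist _ [::] nilB).
have /choice[x hx] n : exists x, sval (L n.+1) = x :: sval (L n) /\
    forall u, u \in sval (L n) -> e < d u x.
  by rewrite /L/=; case: (nxt _) => L' [x ? ?]; exists x.
have xL k l : (k < l)%N -> x k \in sval (L l).
  elim: l => // l IH; rewrite ltnS leq_eqVlt; have [-> _] := hx l.
  by rewrite inE => /predU1P[->|/IH->]; rewrite ?eqxx ?orbT.
have [a ha] := d_cluster x.
have e20 : 0 < e / 2 by rewrite divr_gt0.
have [k _ ak] := ha _ 0%N e20; have [l kl al] := ha _ k.+1 e20.
have := (hx l).2 _ (xL _ _ kl).
by have := d_tri a (x k) (x l); rewrite (d_sym _ a); lra.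
Qed.

Lemma separated_finite (B : set X) e : 0 < e ->
  (forall x y, B x -> B y -> x != y -> e <= d x y) -> finite_set B.
Proof.
move=> e0 Bsep; have e20 : 0 < e / 2 by rewrite divr_gt0.
have [L [LB BL]] := finite_net B e20.
apply: (@sub_finite_set _ _ [set` L]); last exact: finite_seq.
move=> x Bx; have [u uL ux] := BL x Bx.
have [<-//|nux] := eqVneq u x.
by have := Bsep _ _ (LB _ uL) Bx nux; lra.
Qed.

(* [D x] is the conformal derivative of [S] at [x], [growth n x] below that of
   [S^n]. *)
Variables (J : set X) (S : X -> X) (D : X -> R) (A M r0 rho : R).
Hypothesis J_closed : dclosed J.
Hypothesis SJ : forall x, J x -> J (S x).
Hypothesis SJ_inv : forall x, J (S x) -> J x.
Hypothesis S_conf : forall x y, `|d (S x) (S y) - D x * d x y| <= A * d x y ^+ 2.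
Hypothesis M_ge1 : 1 <= M.
Hypothesis S_lip : forall x y, d (S x) (S y) <= M * d x y.
Hypothesis D_ge8 : forall x, J x -> 8 <= D x.
Hypothesis A_ge0 : 0 <= A.
Hypothesis r0_gt0 : 0 < r0.
Hypothesis Ar0 : A * r0 <= 1.
Hypothesis rho_gt0 : 0 < rho.
Hypothesis rho_r0 : 4 * rho <= r0.
Hypothesis S_lift : forall x y', d (S x) y' <= rho -> exists2 y, d x y <= r0 & S y = y'.

(** * Expansion and shadowing of orbits *)

Lemma S_expands x y : J x -> d x y <= r0 -> 2 * d x y <= d (S x) (S y).
Proof.
move=> Jx xy; have := S_conf x y; rewrite ler_norml => /andP[+ _].
have D8 := D_ge8 Jx; have d0 := d_ge0 x y.
(* Within [r0] the quadratic error is at most [d x y], so the expansion factor is at least 8 - 1;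
   the factor 2 is a convenient weakening. *)
have : A * d x y <= 1 by apply: le_trans Ar0; rewrite ler_wpM2l.
rewrite expr2 mulrA => /(ler_wpM2r d0); rewrite mul1r.
have := ler_wpM2r d0 D8; lra.
Qed.

Lemma S_iter_J n x : J x -> J (iter n S x).
Proof. by move=> Jx; elim: n => //= n; apply: SJ. Qed.

Lemma S_iter_lip n x y : d (iter n S x) (iter n S y) <= M ^+ n * d x y.
Proof.
elim: n => [|n IH]; first by rewrite expr0 mul1r.
apply: le_trans (S_lip _ _) _; rewrite exprS -mulrA ler_wpM2l//.
by apply: le_trans M_ge1.
Qed.

(* [d (S^j x) (S^j y) <= 2^(j - n) c] for all [j <= n]. *)
Fixpoint shadows n c x y : Prop := if n is n'.+1 then
  d x y * 2 ^+ n <= c /\ shadows n' c (S x) (S y) else d x y <= c.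

Lemma shadows_first n c x y : shadows n c x y -> d x y * 2 ^+ n <= c.
Proof. by case: n => [|n] /=; [rewrite mulr1|case]. Qed.

Lemma shadows_le n c x y : shadows n c x y -> d x y <= c.
Proof.
move=> /shadows_first; apply: le_trans; rewrite ler_peMr// exprn_ege1//.
by rewrite ler1n.
Qed.

Lemma shadows_last n c x y : shadows n c x y -> d (iter n S x) (iter n S y) <= c.
Proof. by elim: n x y => //= n IH x y [_ /IH]; rewrite -!iterSr. Qed.

Lemma shadowsC n c x y : shadows n c x y -> shadows n c y x.
Proof.
by elim: n x y => /= [|n IH] x y; rewrite (d_sym y x)// => -[? /IH].
Qed.

Lemma shadowsW n c c' x y : c <= c' -> shadows n c x y -> shadows n c' x y.
Proof.
move=> cc; elim: n x y => /= [|n IH] x y; first by move=> /le_trans; apply.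
by move=> [xy /IH]; split => //; apply: le_trans cc.
Qed.

Lemma shadows_trans n c c' x y z :
  shadows n c x y -> shadows n c' y z -> shadows n (c + c') x z.
Proof.
elim: n x y z => /= [|n IH] x y z; first by have := d_tri y x z; lra.
move=> [xy sxy] [yz syz]; split; last exact: IH sxy syz.
apply: le_trans (lerD xy yz); rewrite -mulrDl ler_wpM2r// exprn_ge0//.
Qed.

(** One factor [M] per step pays for the Lipschitz growth of the distance, one factor 2 for the
    decay that shadowing demands. *)
Lemma shadows_near n c x y : d x y * (2 * M) ^+ n <= c -> shadows n c x y.
Proof.
have M0 : 0 <= M by apply: le_trans M_ge1.
elim: n x y => /= [|n IH] x y; first by rewrite mulr1.
move=> xy; split.
  apply: le_trans xy; rewrite ler_wpM2l// lerXn2r ?nnegrE ?mulr_ge0//.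
  by rewrite ler_peMr.
apply: IH; apply: le_trans xy; rewrite exprS mulrA ler_wpM2r//.
  by rewrite exprn_ge0// mulr_ge0.
apply: le_trans (S_lip _ _) _; rewrite mulrC ler_wpM2l// ler_peMl//; lra.
Qed.

Lemma shadows_closed n c x : dclosed [set y | shadows n c x y].
Proof.
elim: n x => /= [|n IH] x; first exact: dclosed_le.
apply: (@dclosedI [set y | d x y * 2 ^+ n.+1 <= c] [set y | shadows n c (S x) (S y)]).
  have -> : [set y | d x y * 2 ^+ n.+1 <= c] = [set y | d x y <= c / 2 ^+ n.+1].
    by apply/seteqP; split => y /=; rewrite ler_pdivlMr ?exprn_gt0.
  exact: dclosed_le.
apply: (@dclosed_preimage S M [set y | shadows n c (S x) y]) => //.
by apply: lt_le_trans M_ge1.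
Qed.

Lemma shadows_expand n x y : J x -> shadows n r0 x y ->
  2 ^+ n * d x y <= d (iter n S x) (iter n S y).
Proof.
elim: n x y => [|n IH] x y Jx; first by rewrite mul1r.
move=> s; have := S_expands Jx (shadows_le s); case: s => _ /(IH _ _ (SJ Jx)).
rewrite !iterSr => h1 h2; apply: le_trans h1.
by rewrite exprSr -mulrA ler_wpM2l// exprn_ge0.
Qed.

(** * Derivatives of iterates and bounded distortion *)

Fixpoint growth n x : R := if n is n'.+1 then D x * growth n' (S x) else 1.

Lemma growth_ge n x : J x -> 8 ^+ n <= growth n x.
Proof.
elim: n x => //= n IH x Jx; rewrite exprS ler_pM ?exprn_ge0 ?D_ge8//.
exact/IH/SJ.
Qed.

Lemma growth_gt0 n x : J x -> 0 < growth n x.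
Proof. by move=> /(growth_ge n); apply: lt_le_trans; rewrite exprn_gt0. Qed.

(** With [n] steps left the two points are [r0 / 2 ^+ n] close, so the relative errors of the
    successive steps decay geometrically and their product stays bounded. The terms in [h] make the
    induction close: both constants equal 1 at [n = 0] and relax towards 1/2 and 2. *)
Lemma distortion n x y : J x -> shadows n r0 x y ->
  let h := (2 ^+ n)^-1 in
  (2^-1 + h / 2) * (growth n x * d x y) <= d (iter n S x) (iter n S y) <=
  (2 - h) * (growth n x * d x y).
Proof.
elim: n x y => [|n IH] x y Jx.
  by move=> _ /=; rewrite expr0 invr1 mul1r; apply/andP; split; lra.
move=> s; have f := shadows_first s; case: s => _ /(IH _ _ (SJ Jx)) /=.
rewrite -!iterSr; set h' := (2 ^+ n)^-1; set h := (2 ^+ n.+1)^-1.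
have h'E : h' = 2 * h by rewrite /h exprS invfM mulrA divff ?mul1r.
have h0 : 0 < h by rewrite invr_gt0 exprn_gt0.
have h1 : 2 * h <= 1 by rewrite -h'E invf_le1 ?exprn_gt0// exprn_ege1// ler1n.
have D8 := D_ge8 Jx; have d0 := d_ge0 x y.
have g0 := ltW (growth_gt0 n (SJ Jx)).
set g := growth n (S x) in g0 *; set dn := d (iter _ _ _) _.
have Ad : A * d x y <= h.
  rewrite /h -div1r ler_pdivlMr ?exprn_gt0// -mulrA.
  by apply: le_trans Ar0; rewrite ler_wpM2l.
(* [D x >= 8] turns the absolute error [A * d x y <= h] into a relative error [h / 8]. *)
have {Ad}Ad : A * d x y ^+ 2 <= h / 8 * (D x * d x y).
  rewrite expr2 mulrA mulrA ler_wpM2r//; apply: le_trans Ad _.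
  by rewrite -mulrA ler_peMr; lra.
have := S_conf x y; rewrite ler_distl => /andP[lo hi].
set E := D x * d x y in Ad lo hi.
have E0 : 0 <= E by rewrite mulr_ge0//; lra.
have lo' : (1 - h / 8) * E <= d (S x) (S y) by lra.
have hi' : d (S x) (S y) <= (1 + h / 8) * E by lra.
have -> : D x * g * d x y = g * E by rewrite /E; ring.
have gE : 0 <= g * E by rewrite mulr_ge0.
rewrite h'E; move=> /andP[l u]; apply/andP; split.
  apply: le_trans l; apply: (@le_trans _ _ ((2^-1 + 2 * h / 2) * (g * ((1 - h / 8) * E)))).
    have -> : (2^-1 + 2 * h / 2) * (g * ((1 - h / 8) * E)) =
       ((2^-1 + 2 * h / 2) * (1 - h / 8)) * (g * E) by ring.
    rewrite ler_wpM2r//; nra.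
  by rewrite ler_wpM2l ?ler_wpM2l//; lra.
apply: le_trans u _; apply: (@le_trans _ _ ((2 - 2 * h) * (g * ((1 + h / 8) * E)))).
  by rewrite ler_wpM2l ?ler_wpM2l//; lra.
have -> : (2 - 2 * h) * (g * ((1 + h / 8) * E)) =
   ((2 - 2 * h) * (1 + h / 8)) * (g * E) by ring.
by rewrite ler_wpM2r//; nra.
Qed.

Lemma distortion2 n x y : J x -> shadows n r0 x y ->
  growth n x * d x y / 2 <= d (iter n S x) (iter n S y) <= 2 * (growth n x * d x y).
Proof.
move=> Jx /(distortion Jx) /=; set h := (2 ^+ n)^-1; set a := _ * d x y.
have a0 : 0 <= a by rewrite mulr_ge0// ltW// growth_gt0.
have h0 : 0 <= h * a by rewrite mulr_ge0// invr_ge0 exprn_ge0.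
by rewrite mulrDl mulrBl (mulrAC h); lra.
Qed.

(** * Inverse branches, cylinders and returns *)

Lemma S_iter_lift n x y' : J x -> J y' -> d (iter n S x) y' <= rho ->
  exists y, [/\ J y, iter n S y = y' & shadows n (d (iter n S x) y') x y].
Proof.
elim: n x => [|n IH] x Jx Jy' xy'; first by exists y'; split => //=.
(* The orbit of [S x] is lifted first, then one more step is lifted through [S] at [x]. By
   [S_expands] each lift at least halves the distance, which is the decay required by [shadows]. *)
rewrite iterSr in xy' *; have [y1 [Jy1 y1y' s1]] := IH _ (SJ Jx) Jy' xy'.
have [y xy Sy] := S_lift (le_trans (shadows_le s1) xy').
exists y; split; first by apply: SJ_inv; rewrite Sy.
  by rewrite iterSr Sy.
split; last by rewrite Sy.
have := S_expands Jx xy; rewrite Sy => h.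
apply: le_trans (shadows_first s1).
by rewrite exprS mulrA (mulrC _ 2) ler_wpM2r// exprn_ge0.
Qed.

(** For [u] in [J], this is the image within [J] of the closed [rho]-ball about [iter n S u] under
    the inverse branch of [S^n] at [u]. *)
Definition cylinder n u y := J y /\ shadows n rho u y.

Lemma cylinder_shadows n u y y' : cylinder n u y -> cylinder n u y' ->
  shadows n r0 y y'.
Proof.
move=> [_ /shadowsC sy] [_ sy']; apply: shadowsW (shadows_trans sy sy'); move: rho_gt0 rho_r0; lra.
Qed.

(** Bounded distortion: applying [distortion2] to the pair [u], [y] from either end shows that
    [growth n y] is at most 4 times [growth n u]; the pair [y], [y'] costs another factor 2. *)
Lemma cylinder_lip n u y y' : J u -> cylinder n u y -> cylinder n u y' ->
  d (iter n S y) (iter n S y') <= 8 * growth n u * d y y'.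
Proof.
move=> Ju uy uy'; have := distortion2 uy.1 (cylinder_shadows uy uy').
move=> /andP[_ /le_trans]; apply; rewrite mulrA ler_wpM2r//.
suff : growth n y <= 4 * growth n u by lra.
have s : shadows n r0 u y by apply: shadowsW uy.2; move: rho_gt0 rho_r0; lra.
have /andP[_ h1] := distortion2 Ju s.
have /andP[+ _] := distortion2 uy.1 (shadowsC s).
rewrite (d_sym (iter n S y)) => /le_trans/(_ h1) {h1}.
have := d_ge0 y u; rewrite le_eqVlt eq_sym => /predU1P[/d_eq0->|yu].
  by have := ltW (growth_gt0 n Ju); lra.
rewrite (d_sym u) => h; rewrite -(@ler_pM2r _ (d y u))//; lra.
Qed.

Lemma cylinder_diam n u y y' : J u -> cylinder n u y -> cylinder n u y' ->
  d y y' <= 4 * rho / growth n u.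
Proof.
move=> Ju.
have h z : cylinder n u z -> d u z <= 2 * rho / growth n u.
  move=> [Jz uz]; have s : shadows n r0 u z by apply: shadowsW uz; move: rho_gt0 rho_r0; lra.
  rewrite ler_pdivlMr ?growth_gt0// mulrC.
  by have /andP[+ _] := distortion2 Ju s; have := shadows_last uz; lra.
move=> /h + /h; have := d_tri u y y'; rewrite (d_sym y u).
by rewrite -!mulrA mulrCA; lra.
Qed.

Lemma shadows_inj n u u' : J u -> iter n S u = iter n S u' -> shadows n r0 u u' -> u = u'.
Proof.
move=> Ju uu /(shadows_expand Ju); rewrite uu d_self pmulr_rle0 ?exprn_gt0// => h.
by apply: d_eq0; apply/eqP; rewrite eq_le h d_ge0.
Qed.

(** If two such cylinders came too close, [u] would shadow [u'] within [3 * rho <= r0]; by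
    expansion, shadowing orbits with the same endpoint coincide. *)
Lemma cylinder_gap n : exists2 e, 0 < e & forall u u' y y', J u ->
  iter n S u = iter n S u' -> u != u' -> cylinder n u y -> cylinder n u' y' ->
  e <= d y y'.
Proof.
have M2 : 0 < (2 * M) ^+ n.
  by rewrite exprn_gt0// mulr_gt0//; apply: lt_le_trans M_ge1.
exists (rho / (2 * M) ^+ n); first by rewrite divr_gt0.
move=> u u' y y' Ju uu nu uy u'y'; rewrite leNgt; apply/negP => yy.
move: nu => /eqP; apply; apply: (shadows_inj Ju uu).
have yy' : shadows n rho y y'.
  by apply: shadows_near; rewrite -ler_pdivlMr// ltW.
apply: shadowsW (shadows_trans uy.2 (shadows_trans yy' (shadowsC u'y'.2))); move: rho_gt0 rho_r0; lra.
Qed.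

Lemma cylinder_disjoint n u u' y : J u -> iter n S u = iter n S u' ->
  cylinder n u y -> cylinder n u' y -> u = u'.
Proof.
move=> Ju uu uy u'y; apply/eqP/negP => /negP nu.
have [e e0 /(_ u u' y y Ju uu nu uy u'y)] := cylinder_gap n.
by rewrite d_self; lra.
Qed.

Lemma cylinder_closed n u : dclosed (cylinder n u).
Proof. by apply: dclosedI => //; apply: shadows_closed. Qed.

(** The point [u] labels an inverse branch of [S^n] on the [rho]-ball about [b]. Asking its image to
    meet the half ball makes the whole image fall back into the ball once [n >= 3], as [return_sub]
    shows. *)
Definition returns n b u :=
  [/\ J u, iter n S u = b & exists2 y, cylinder n u y & d b y <= rho / 2].

(** For [n >= 3] the cylinder lies within [rho / 8] of [u], and 1/2 + 1/8 + 1/8 is below 1. *)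
Lemma return_sub n b u y : (3 <= n)%N -> returns n b u -> cylinder n u y -> d b y <= rho.
Proof.
move=> n3 [Ju _ [y0 [_ s0] by0]] [_ s].
have h z : shadows n rho u z -> d u z <= rho / 8.
  move=> /shadows_first; rewrite -ler_pdivlMr ?exprn_gt0//; move/le_trans; apply.
  rewrite ler_wpM2l ?(ltW rho_gt0)// lef_pV2 ?posrE ?exprn_gt0//.
  have -> : 8 = 2 ^+ 3 :> R by rewrite -natrX.
  by rewrite ler_eXn2l// ltr1n.
have := h _ s0; have := h _ s; have := d_tri y0 b y; have := d_tri u y0 y.
by rewrite (d_sym y0 u); have := rho_gt0; lra.
Qed.

(** Each return lies in its own cylinder, so [cylinder_gap] separates the returns uniformly and
    compactness leaves finitely many. *)
Lemma return_finite n b : exists2 L : seq X, uniq L & forall u, u \in L <-> returns n b u.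
Proof.
have /finite_seqP[L hL] : finite_set (returns n b).
  have [e e0 he] := cylinder_gap n.
  apply: (separated_finite e0) => x y [Jx bx _] [Jy bY _] xy.
  have c u : J u -> cylinder n u u.
    by move=> Ju; split=> //; apply: shadows_near; rewrite d_self mul0r ltW.
  by apply: (he x y) => //; rewrite ?bx ?bY//; apply: c.
exists (undup L); first exact: undup_uniq.
by move=> u; rewrite mem_undup hL.
Qed.

(** * Limit sets of systems of branches of total weight at least 1 *)

Section LimitSet.
Variables (s : R) (b : X) (n : nat) (F : seq X).
Hypothesis s_gt0 : 0 < s.
Hypothesis Jb : J b.
Hypothesis F_uniq : uniq F.
Hypothesis F_lift : forall u, u \in F -> J u /\ iter n S u = b.
Hypothesis F_sub : forall u y, u \in F -> cylinder n u y -> d b y <= rho.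
Hypothesis F_sum : 1 <= \sum_(u <- F) (8 * growth n u) `^ (- s).

Definition limit_set := [set z | J z /\
  forall m, exists2 u, u \in F & cylinder n u (iter (m * n) S z)].

Section Stage.
Variables (U : nat -> set X) (w : nat -> R) (e : R).

(** The invariant of the descent: [C] is a piece of [J] that [S^k] carries onto the [rho]-ball about
    [b], [q] bounds from below its contraction ratio, and the covering sets that meet [C], rescaled
    by [1 / q], still have total weight at most [e]. *)
Definition stage (C : set X) k q :=
  [/\ C `<=` J /\ dclosed C,
      0 < q,
      forall y, J y -> d b y <= rho -> exists2 z, C z & iter k S z = y,
      forall z z', C z -> C z' -> q * d (iter k S z) (iter k S z') <= d z z' &
      forall N, \sum_(0 <= i < N | `[< U i `&` C !=set0 >]) w i <= e * q `^ s].

Definition refine (C : set X) k u := C `&` [set z | cylinder n u (iter k S z)].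

Variable gap : R.
Hypothesis gap_gt0 : 0 < gap.
Hypothesis gapP : forall u u' y y', u \in F -> u' \in F -> u != u' ->
  cylinder n u y -> cylinder n u' y' -> gap <= d y y'.
Hypothesis w_ge0 : forall i, 0 <= w i.
Hypothesis Uw : forall i x y, U i x -> U i y -> d x y `^ s <= w i.
Hypothesis e_gt0 : 0 < e.
Hypothesis e_gap : e < gap `^ s.

(** A covering set that meets two sub-pieces has diameter at least [q * gap], so by [e_gap] it alone
    outweighs all that the stage allows. *)
Lemma stage_unique C k q i u u' : stage C k q -> u \in F -> u' \in F ->
  U i `&` refine C k u !=set0 -> U i `&` refine C k u' !=set0 -> u = u'.
Proof.
move=> [_ q0 _ Cq Ce] uF u'F [z [Uz [Cz uz]]] [z' [Uz' [Cz' uz']]].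
apply/eqP/negP => /negP nu.
have h1 : q * gap <= d z z'.
  by apply: le_trans (Cq _ _ Cz Cz'); rewrite ler_pM2l//; apply: gapP uz uz'.
have h2 : (q * gap) `^ s <= w i.
  apply: le_trans (Uw Uz Uz').
  by rewrite ge0_ler_powR ?nnegrE ?mulr_ge0 ?(ltW q0) ?(ltW gap_gt0)// ltW.
have h3 : w i <= e * q `^ s.
  apply: le_trans (Ce i.+1); rewrite big_mkcond big_nat_recr//=.
  case: asboolP => [_|[]]; last by exists z.
  by rewrite lerDr; apply: sumr_ge0 => j _; case: ifP.
have := le_trans h2 h3; rewrite powRM ?(ltW q0) ?(ltW gap_gt0)// mulrC.
by rewrite ler_pM2r ?powR_gt0// leNgt e_gap.
Qed.

(** Pigeonhole: if the cover were too heavy on every sub-piece, summing over [F] with [F_sum] would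
    exceed the weight available on [C], since each covering set is charged to at most one
    sub-piece. *)
Lemma stage_sum C k q : stage C k q -> exists2 u, u \in F &
  forall N, \sum_(0 <= i < N | `[< U i `&` refine C k u !=set0 >]) w i
    <= e * (q / (8 * growth n u)) `^ s.
Proof.
move=> st; apply: contrapT => nu.
have /choice[f hf] u : exists N, u \in F -> e * (q / (8 * growth n u)) `^ s <
    \sum_(0 <= i < N | `[< U i `&` refine C k u !=set0 >]) w i.
  apply: contrapT => nN; apply: nu.
  case: (boolP (u \in F)) => uF; last by case: nN; exists 0%N; rewrite (negbTE uF).
  exists u => // N; rewrite leNgt; apply/negP => h; apply: nN; by exists N.
pose N := (\max_(u <- F) f u)%N.
have lt u : u \in F -> e * (q / (8 * growth n u)) `^ s <
    \sum_(0 <= i < N | `[< U i `&` refine C k u !=set0 >]) w i.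
  move=> uF; apply: lt_le_trans (hf u uF) _; apply: ler_psum => //.
  by rewrite /N (big_rem u)//= leq_maxl.
case: (st) => _ q0 _ _ /(_ N); apply/negP; rewrite -ltNge.
(* [F] is nonempty because its weight is at least 1; this keeps the inequality between the sums
   strict. *)
have F0 : has predT F.
  by case: (F) F_sum => // /[!big_nil]; rewrite ler10.
apply: (@lt_le_trans _ _ (\sum_(u <- F)
    \sum_(0 <= i < N | `[< U i `&` refine C k u !=set0 >]) w i)).
  apply: (@le_lt_trans _ _ (\sum_(u <- F) e * (q / (8 * growth n u)) `^ s)).
    rewrite -mulr_sumr ler_pM2l//.
    apply: (@le_trans _ _ (q `^ s * \sum_(u <- F) (8 * growth n u) `^ (- s))).
      by rewrite ler_peMr// powR_ge0.
    rewrite mulr_sumr le_eqVlt; apply/orP; left; apply/eqP.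
    rewrite big_seq [RHS]big_seq; apply: eq_bigr => u /F_lift[Ju _].
    have g0 : 0 < 8 * growth n u by rewrite mulr_gt0// growth_gt0.
    by rewrite [RHS]powRM ?invr_ge0 ?ltW// -[X in _ = _ * X `^ s]powR_inv1 ?ltW// -powRrM mulN1r.
  rewrite big_seq [ltRHS]big_seq; apply: ltr_sum => //.
  by apply/hasP; case/hasP: F0 => u uF _; exists u.
under eq_bigr do rewrite big_mkcond.
(* After the exchange, [w i] is multiplied by the number of sub-pieces that [U i] meets. *)
rewrite exchange_big/= [leRHS]big_mkcond/=; apply: ler_sum => i _.
rewrite -big_mkcond/= big_const_seq iter_addr_0.
set P := (fun u => _).
have c1 : (count P F <= 1)%N.
  apply: count_le1 => // u u' uF u'F /asboolW Pu /asboolW Pu'.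
  exact: stage_unique st uF u'F Pu Pu'.
case: asboolP => [_|nC].
  by case: (count P F) c1 => [|[|]]//; rewrite ?mulr0n ?mulr1n.
rewrite (_ : count P F = 0%N) ?mulr0n//; apply/eqP; rewrite -leqn0 leqNgt -has_count.
apply/negP => /hasP[u uF /asboolW[z [Uz [Cz _]]]]; apply: nC; by exists z.
Qed.

(** The ratio [q] is divided by the Lipschitz constant of [S^n] on the cylinder. Surjectivity
    persists because the branch at [u] lifts the ball into itself by [F_sub]. *)
Lemma stage_next C k q : stage C k q ->
  exists2 u, u \in F & stage (refine C k u) (n + k) (q / (8 * growth n u)).
Proof.
move=> st; have [u uF us] := stage_sum st; exists u => //.
have [Ju Sub] := F_lift uF; have g0 := growth_gt0 n Ju.
case: st => -[CJ Ccl] q0 Csurj Cq _; split => //.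
- split; first by apply: subset_trans CJ; apply: subIsetl.
  apply: dclosedI => //; apply: (@dclosed_preimage (iter k S) (M ^+ k)).
  + by rewrite exprn_gt0//; apply: lt_le_trans M_ge1.
  + exact: S_iter_lip.
  + exact: cylinder_closed.
- by rewrite divr_gt0// mulr_gt0.
- move=> y Jy by_.
  have [|y1 [Jy1 y1y s1]] := @S_iter_lift n u y Ju Jy; first by rewrite Sub.
  have cy1 : cylinder n u y1 by split=> //; apply: shadowsW s1; rewrite Sub.
  have [z Cz zy1] := Csurj _ Jy1 (F_sub uF cy1).
  by exists z; [split; rewrite //= zy1|rewrite iterD zy1].
- move=> z z' [Cz uz] [Cz' uz']; apply: le_trans (Cq _ _ Cz Cz').
  rewrite !iterD -mulrA ler_pM2l// mulrC ler_pdivrMr ?mulr_gt0// mulrC.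
  exact: cylinder_lip.
Qed.

(** Dependent choice iterates [stage_next]. Since [growth n u >= 1], each division by
    [8 * growth n u] shrinks [q] at least eightfold. *)
Lemma stage_chain : stage (J `&` [set y | d b y <= rho]) 0 1 ->
  exists C q, [/\ forall m, stage (C m) (m * n) (q m),
    forall m, C m.+1 `<=` C m, forall m, q m <= (8 ^+ m)^-1 &
    forall m z, C m.+1 z -> exists2 u, u \in F & cylinder n u (iter (m * n) S z)].
Proof.
pose T := {t : set X * nat * R | stage t.1.1 t.1.2 t.2}.
move=> st0.
have nxt (t : T) : {t' : T | exists2 u, u \in F &
    sval t' = (refine (sval t).1.1 (sval t).1.2 u, n + (sval t).1.2,
               (sval t).2 / (8 * growth n u))%N}.
  apply: cid; case: t => -[[C k] q]/= st; have [u uF st'] := stage_next st.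
  by exists (exist (fun t => stage t.1.1 t.1.2 t.2) (_, _, _) st'), u.
pose t0 : T := exist (fun t => stage t.1.1 t.1.2 t.2) (_, _, _) st0.
pose t m := iter m (fun t => sval (nxt t)) t0.
have tS m : exists2 u, u \in F &
    sval (t m.+1) = (refine (sval (t m)).1.1 (sval (t m)).1.2 u, n + (sval (t m)).1.2,
               (sval (t m)).2 / (8 * growth n u))%N.
  by rewrite /t/=; case: (nxt _).
have kE m : (sval (t m)).1.2 = (m * n)%N.
  elim: m => [|m IH]; first by rewrite mul0n.
  by have [u _ ->] := tS m; rewrite /= IH mulSn.
exists (fun m => (sval (t m)).1.1), (fun m => (sval (t m)).2); split.
- by move=> m; rewrite -kE; case: (t m).
- by move=> m; have [u _ ->] := tS m; apply: subIsetl.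
- elim=> [|m IH]; first by rewrite expr0 invr1.
  have [u uF ->] /= := tS m; have [Ju _] := F_lift uF.
  have g1 : 1 <= growth n u.
    by apply: le_trans (growth_ge n Ju); rewrite exprn_ege1// ler1n.
  rewrite exprS [leRHS]invfM [leRHS]mulrC ler_pM ?invr_ge0 ?mulr_ge0//.
  + by case: (svalP (t m)) => _ /ltW.
  + by rewrite ltW// growth_gt0.
  + by rewrite lef_pV2 ?posrE ?mulr_gt0 ?growth_gt0//; lra.
- by move=> m z; have [u uF ->] := tS m => -[_]; rewrite /= kE; exists u.
Qed.

End Stage.

Lemma limit_set_not_null : ~ snull d s limit_set.
Proof.
have [gap gap0 hgap] := cylinder_gap n.
have gapP u u' y y' : u \in F -> u' \in F -> u != u' ->
    cylinder n u y -> cylinder n u' y' -> gap <= d y y'.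
  move=> uF u'F nu; apply: hgap => //; first by case: (F_lift uF).
  by case: (F_lift uF) (F_lift u'F) => _ -> [_ ->].
have gs : 0 < gap `^ s by rewrite powR_gt0.
(* Any value strictly between 0 and the bound in [e_gap] would do; half of it is spent on the cover
   and half on the perturbation below. *)
pose e := gap `^ s / 2; have e0 : 0 < e by rewrite divr_gt0.
have eg : e < gap `^ s by rewrite /e; lra.
have e20 : 0 < e / 2 by rewrite divr_gt0.
move=> /(_ _ e20)[U [w' [w'0 Uw' LU w'e]]].
(* A summable perturbation makes every weight strictly positive, so that weights tending to 0 give a
   contradiction. *)
pose w i := w' i + e / 2 / 2 ^+ i.+1.
have p0 i : 0 < e / 2 / 2 ^+ i.+1 by rewrite divr_gt0// exprn_gt0.
have w0 i : 0 < w i by rewrite ltr_wpDl.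
have w0' i : 0 <= w i by apply: ltW.
have Uw i x y : U i x -> U i y -> d x y `^ s <= w i.
  by move=> Ux /(Uw' _ _ _ Ux) /le_trans; apply; rewrite lerDl ltW.
have we N : \sum_(0 <= i < N) w i <= e.
  rewrite big_split/= [leRHS](_ : e = e / 2 + e / 2); last by lra.
  by rewrite lerD// half_sum// ltW.
have st0 : stage U w e (J `&` [set y | d b y <= rho]) 0 1.
  split => //.
  - by split; [apply: subIsetl|apply: dclosedI => //; apply: dclosed_le].
  - by move=> y Jy by_; exists y.
  - by move=> z z' _ _; rewrite mul1r.
  - move=> N; rewrite powR1 mulr1; apply: le_trans (we N).
    by rewrite big_mkcond; apply: ler_sum => i _; case: ifP.
have [C [q [Cst Cdec q8 Ccyl]]] := stage_chain gap0 gapP w0' Uw e0 eg st0.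
have [|||z Cz] := nested_point (C := C) => //.
- by move=> m; case: (Cst m) => -[].
- move=> m; case: (Cst m) => _ _ /(_ b Jb) + _ _; rewrite d_self.
  by case=> [|z Cz _]; [apply: ltW|exists z].
have Lz : limit_set z.
  split; last by move=> m; apply: Ccyl (Cz m.+1).
  by have [[CJ _] _ _ _ _] := Cst 0%N; apply: CJ.
(* The covering set through [z] meets every [C m], so [w i] is at most [e] times the [s]-th power of
   [q m], which tends to 0. *)
have [i _ Uz] := LU z Lz.
have wq m : w i <= e * q m `^ s.
  case: (Cst m) => _ _ _ _ /(_ i.+1); apply: le_trans.
  rewrite big_mkcond big_nat_recr//=; case: asboolP => [_|[]]; last by exists z.
  by rewrite lerDr; apply: sumr_ge0 => j _; case: ifP.
have t1 : 8 `^ (- s) < 1 :> R.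
  have : 1 `^ s < 8 `^ s :> R by apply: gt0_ltr_powR; rewrite ?nnegrE ?ltr1n.
  by rewrite powR1 powRN invf_lt1 ?powR_gt0.
have [|m hm] := geometric_small (powR_ge0 _ _) t1 (e := w i / e).
  by rewrite divr_gt0.
have := wq m; apply/negP; rewrite -ltNge -ltr_pdivlMl// mulrC.
apply: le_lt_trans hm; have [_ q0 _ _ _] := Cst m.
rewrite -powR_mulrn ?powR_ge0// -powRrM mulNr mulrC -mulNr mulrC.
rewrite mulrC powRrM powRN powR_mulrn//.
by rewrite ge0_ler_powR ?nnegrE ?invr_ge0 ?exprn_ge0// ltW.
Qed.

End LimitSet.

(** On a set of diameter at most [r0] the map [S] expands, so pulling a cover back does not increase
    diameters; finitely many such sets exhaust [J]. *)
Lemma preimage_null s B : snull d s B -> 0 <= s -> snull d s [set y | J y /\ B (S y)].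
Proof.
move=> nB s0.
have [L [LJ JL]] := finite_net J (divr_gt0 r0_gt0 (ltr0n R 2)).
(* [ohead (drop k L)] is the [k]-th net point; it is an option, so [nth] with its default point is
   avoided. *)
have nk k : snull d s [set y | [/\ (k < size L)%N, J y, B (S y) &
    forall u, ohead (drop k L) = Some u -> d u y <= r0 / 2]].
  move=> e /nB[U [w [w0 Uw BU we]]].
  exists (fun i => [set y | [/\ (k < size L)%N, J y, U i (S y) &
    forall u, ohead (drop k L) = Some u -> d u y <= r0 / 2]]), w; split => //.
    move=> i x y [kL Jx Ux ux] [_ Jy Uy uy]; apply: le_trans (Uw _ _ _ Ux Uy).
    case E : (drop k L) ux uy => [|u L'].
      by have := size_drop k L; rewrite E => /esym/eqP; rewrite subn_eq0 leqNgt kL.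
    move=> /(_ u erefl) ux /(_ u erefl) uy.
    have xy : d x y <= r0 by have := d_tri u x y; rewrite (d_sym x u); lra.
    rewrite ge0_ler_powR ?nnegrE//.
    by have := S_expands Jx xy; have := d_ge0 x y; lra.
  move=> y [kL Jy By uy]; have [i _ Uy] := BU _ By; by exists i.
apply: snullW (snull_bigcup nk) => y [Jy By].
have [u uL uy] := JL _ Jy; exists (index u L) => //; split; rewrite ?index_mem//.
by move=> v; rewrite (drop_nth u) ?index_mem// nth_index// => -[<-].
Qed.

(** * Linear growth of return weights and nullity of the whole repeller *)

Section Dichotomy.
Variables (forbidden : nat -> X) (N : nat) (B : set X) (s s' : R).
Hypothesis s_gt0 : 0 < s.
Hypothesis s_lt : s < s'.
(** In the application [S = T^N], [forbidden k] is [T^k z0] and [B] is the bad set. *)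
Hypothesis B_absorbs : forall (L : set X) n c, (0 < n)%N -> 0 < c -> L `<=` J ->
  (forall z, L z -> L (iter n S z)) ->
  (forall z k, L z -> (0 < k <= n * N)%N -> c <= d (forbidden k) z) -> L `<=` B.
Hypothesis B_null : snull d s B.

Lemma growth_weight_le1 n u : J u -> (8 * growth n u) `^ (- s) <= 1.
Proof.
move=> Ju; have : 1 `^ s <= (8 * growth n u) `^ s.
  have g1 : 1 <= growth n u.
    by apply: le_trans (growth_ge n Ju); rewrite exprn_ege1// ler1n.
  by rewrite ge0_ler_powR ?nnegrE ?(ltW s_gt0)//; lra.
rewrite powR1 powRN => h; rewrite invf_le1//.
by apply: lt_le_trans h.
Qed.

(* Discarding the at most [n * N] returns whose cylinder contains a forbidden
   point leaves a system whose limit set lies in [B]. *)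
Lemma returns_weight b n (L : seq X) : J b -> (3 <= n)%N -> uniq L ->
  (forall u, u \in L -> returns n b u) ->
  \sum_(u <- L) (8 * growth n u) `^ (- s) <= 1 + (n * N)%:R.
Proof.
move=> Jb n3 Lu Lr; rewrite leNgt; apply/negP => big.
pose P k u := `[< cylinder n u (forbidden k) >].
pose hit u := has (P^~ u) (iota 1 (n * N)).
pose F := [seq u <- L | ~~ hit u].
have Fr u : u \in F -> returns n b u by rewrite mem_filter => /andP[_ /Lr].
have w0 u : 0 <= (8 * growth n u) `^ (- s) by apply: powR_ge0.
(* Each forbidden point lies in at most one cylinder, by [cylinder_disjoint], and each branch weighs
   at most 1. *)
have hits : \sum_(u <- L | hit u) (8 * growth n u) `^ (- s) <= (n * N)%:R.
  apply: (@le_trans _ _ (\sum_(u <- L) \sum_(k <- iota 1 (n * N) | P k u) 1)).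
    rewrite [leLHS]big_mkcond/= big_seq [leRHS]big_seq; apply: ler_sum => u uL.
    case: ifP => [/hasP[k kn Pk]|_]; last by apply: sumr_ge0.
    rewrite (big_rem k)//= Pk; apply: le_trans (_ : 1 <= _).
      by apply: growth_weight_le1; case: (Lr u uL).
    by rewrite lerDl; apply: sumr_ge0.
  under eq_bigr do rewrite big_mkcond/=.
  rewrite exchange_big/= -[X in _ <= X%:R](size_iota 1) -sum1_size natr_sum.
  apply: ler_sum => k _; rewrite -big_mkcond/= big_const_seq iter_addr_0 ler_nat.
  apply: count_le1 => // u v uL vL /asboolW Pu /asboolW Pv.
  have [Ju ub _] := Lr u uL; have [_ vb _] := Lr v vL.
  by apply: cylinder_disjoint Pu Pv; rewrite ?ub.
have F1 : 1 <= \sum_(u <- F) (8 * growth n u) `^ (- s).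
  by rewrite big_filter; move: big; rewrite (bigID hit)/=; lra.
have Flift u : u \in F -> J u /\ iter n S u = b by move=> /Fr[].
have Fsub u y : u \in F -> cylinder n u y -> d b y <= rho.
  by move=> /Fr ru; apply: return_sub ru.
apply: (limit_set_not_null s_gt0 Jb (filter_uniq _ Lu) Flift Fsub F1).
apply: snullW B_null.
(* Retained cylinders are closed and miss every forbidden point; as there are finitely many pairs of
   a branch and a time, one distance [c] works for all. *)
have [||c c0 hc] := @uniform_gap R (prod X nat) [seq (u, k) | u <- F, k <- iota 1 (n * N)]
   (fun i c => forall y, cylinder n i.1 y -> c <= d (forbidden i.2) y).
- by move=> i c c' cc h y /h; apply: le_trans.
- move=> i /allpairsP[[u k]/= [uF kn ->]]; apply: dclosed_gap => /=.
    exact: cylinder_closed.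
  move=> uk; move: uF; rewrite mem_filter => /andP[/hasPn/(_ k kn) + _]; apply/negP; rewrite negbK.
  exact/asboolP.
apply: (B_absorbs _ c0) => [|z []//|z [Jz Lz]|z k [_ /(_ 0%N)[u uF uz]] kn].
- by apply: leq_trans n3.
- split; first exact: S_iter_J.
  by move=> m; have [u uF uz] := Lz m.+1; exists u; rewrite // -iterD addnC -mulSn.
- have := hc (u, k); apply => //.
  by apply: allpairs_f => //; rewrite mem_iota add1n ltnS.
Qed.

Definition recurrent b := [set y | [/\ J y, d b y <= rho / 2 &
  forall m, exists2 n, (m <= n)%N & d b (iter n S y) <= rho / 2]].

(** Each late visit to the half ball puts the point in the cylinder of a return, so all cylinders of
    order at least [n1] form a cover. Raising the exponent from [s] to [s'] beats the linear bound
    of [returns_weight] by a geometric factor. *)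
Lemma recurrent_null b : J b -> snull d s' (recurrent b).
Proof.
move=> Jb e e0.
have /choice[L hL] n : exists L : seq X, uniq L /\ forall u, u \in L <-> returns n b u.
  by have [L ? ?] := return_finite n b; exists L.
(* Since [growth n u >= 8 ^+ n], the surplus exponent [s' - s] gains at least a factor [t ^+ n] at
   order [n]. *)
pose t : R := 8 `^ (- (s' - s)).
have t0 : 0 < t by rewrite powR_gt0.
have t1 : t < 1.
  have : 1 `^ (s' - s) < 8 `^ (s' - s) :> R.
    by apply: gt0_ltr_powR; rewrite ?nnegrE ?ltr1n// subr_gt0.
  by rewrite powR1 /t powRN invf_lt1 ?powR_gt0.
have [n0 hn0] := linear_geometric_tail N t0 t1 e0 (powR_ge0 (32 * rho) s').
pose n1 := maxn n0 3.
have n13 k : (3 <= n1 + k)%N by rewrite (leq_trans (leq_maxr n0 3))// leq_addr.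
apply: (scoverW (B := \bigcup_k [set x | exists2 u, u \in L (n1 + k)%N &
    cylinder (n1 + k)%N u x]) (e := e)) => //.
  move=> y [Jy bY /(_ n1)[n nn bn]]; exists (n - n1)%N => //=; rewrite subnKC//.
  have [|u [Ju ub uy]] := @S_iter_lift n y b Jy Jb.
    by rewrite d_sym; move: rho_gt0; lra.
  have cy : cylinder n u y.
    split => //; apply/shadowsC; apply: shadowsW uy.
    by rewrite d_sym; move: rho_gt0; lra.
  exists u => //; apply: ((hL n).2 u).2; split => //; exists y => //.
apply: (scover_bigcup (e := fun k => \sum_(u <- L (n1 + k)%N)
    (4 * rho / growth (n1 + k)%N u) `^ s')).
  move=> k; apply: scover_seq => [u _|u x y uL ux uy]; first exact: powR_ge0.
  have [Ju _ _] := ((hL _).2 u).1 uL.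
  rewrite ge0_ler_powR ?nnegrE//; last exact: cylinder_diam ux uy.
    by rewrite ltW// (lt_trans s_gt0).
  by rewrite divr_ge0 ?mulr_ge0 ?(ltW rho_gt0)// ltW// growth_gt0.
move=> m; apply: le_trans (hn0 n1 m (leq_maxl _ _)).
apply: ler_sum => k _; set n := (n1 + k)%N.
have {}n13 : (3 <= n)%N by apply: n13.
have := returns_weight Jb n13 (hL n).1 (fun u => ((hL n).2 u).1).
have K0 : 0 <= (32 * rho) `^ s' * t ^+ n by rewrite mulr_ge0 ?powR_ge0// exprn_ge0// ltW.
move=> /(ler_wpM2l K0); apply: le_trans; rewrite mulr_sumr.
rewrite big_seq [leRHS]big_seq; apply: ler_sum => u /((hL n).2 u).1[Ju _ _].
have g0 := growth_gt0 n Ju; have G0 : 0 < 8 * growth n u by rewrite mulr_gt0.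
(* The diameter bound is expressed through the [8 * growth n u] of [returns_weight], whence the
   constant 32. *)
have -> : 4 * rho / growth n u = 32 * rho * (8 * growth n u) `^ (-1).
  by rewrite powR_inv1 ?ltW//; field; rewrite gt_eqF.
rewrite powRM ?powR_ge0 ?mulr_ge0 ?(ltW rho_gt0)// -powRrM mulN1r -mulrA.
rewrite ler_wpM2l ?powR_ge0//.
have -> : - s' = - (s' - s) + - s by lra.
rewrite powRD; last by rewrite (gt_eqF G0) implybT.
rewrite ler_wpM2r ?powR_ge0//.
have -> : t ^+ n = (8 ^+ n) `^ (- (s' - s)).
  by rewrite /t -powR_mulrn ?powR_ge0// -powRrM mulrC powRrM powR_mulrn.
rewrite !powRN lef_pV2 ?posrE ?powR_gt0 ?exprn_gt0//.
rewrite ge0_ler_powR ?nnegrE ?exprn_ge0 ?(ltW G0)//; first by rewrite subr_ge0 ltW.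
apply: le_trans (growth_ge n Ju) _; rewrite ler_peMl ?ler1n// ltW//.
Qed.

(** By pigeonhole every orbit in [J] visits the half ball of some point of a finite net infinitely
    often, so [J] is a countable union of iterated preimages of [recurrent] sets. *)
Lemma repeller_null : snull d s' J.
Proof.
have [L [LJ JL]] := finite_net J (divr_gt0 rho_gt0 (ltr0n R 2)).
have s'0 : 0 <= s' by rewrite ltW// (lt_trans s_gt0).
have nm u m : J u -> snull d s' [set y | J y /\ recurrent u (iter m S y)].
  move=> Ju; elim: m => [|m IH].
    by apply: snullW (recurrent_null Ju) => y [].
  apply: snullW (preimage_null IH s'0) => y [Jy uy]; split => //=.
  by split; [exact: SJ|rewrite -iterSr].
have nk k : snull d s' (\bigcup_m [set y |
    exists u, [/\ ohead (drop k L) = Some u, J y & recurrent u (iter m S y)]]).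
  apply: snull_bigcup => m; case E : (drop k L) => [|u L'] /=.
    by apply: snullW (@snull0 _ _ d s') => y [u []].
  have Ju : J u.
    by apply: LJ; apply: (@mem_drop k); rewrite E inE eqxx.
  by apply: snullW (nm u m Ju) => y [v [[<-]]].
apply: snullW (snull_bigcup nk) => y Jy.
have [u uL hu] : exists2 u, u \in L &
    forall m, exists2 n, (m <= n)%N & d u (iter n S y) <= rho / 2.
  (* If every net point [u] were visited only before time [f u], the orbit at the largest [f u]
     would be near no net point. *)
  apply: contrapT => nu.
  have /choice[f hf] u : exists m, u \in L -> forall n, (m <= n)%N -> rho / 2 < d u (iter n S y).
    apply: contrapT => nm'; apply: nu; case: (boolP (u \in L)) => uL; last first.
      by case: nm'; exists 0%N; rewrite (negbTE uL).
    exists u => // m; apply: contrapT => nn; apply: nm'; exists m => _ n mn.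
    by rewrite ltNge; apply/negP => un; apply: nn; exists n.
  have [u uL] := JL _ (S_iter_J (\max_(v <- L) f v) Jy).
  by rewrite leNgt hf// (big_rem u)//= leq_maxl.
have [n _ un] := hu 0%N.
exists (index u L) => //; exists n => //=; exists u; split => //.
  by rewrite (drop_nth u) ?index_mem// nth_index.
split => //; first exact: S_iter_J.
move=> m; have [k mk uk] := hu (m + n)%N; exists (k - n)%N.
  by rewrite leq_subRL ?(leq_trans (leq_addl _ _) mk)// addnC.
by rewrite -iterD subnK// (leq_trans (leq_addl _ _) mk).
Qed.

End Dichotomy.
End Repeller.

(** * The sphere as a projective line *)

Section Vectors.
Variable R : realType.
Local Notation C := R[i].
Local Notation vec := (C * C)%type.
Implicit Types (z c : C) (u v w : vec) (x y : sphere R).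

Lemma normc_ge0 z : 0 <= normc z.
Proof. by case: z => a b; apply: sqrtr_ge0. Qed.

Lemma normcX z n : normc (z ^+ n) = normc z ^+ n.
Proof.
elim: n => [|n IH]; first by rewrite !expr0; apply: normc1.
by rewrite !exprS normcM IH.
Qed.

Lemma normc_eq0 z : (normc z == 0) = (z == 0).
Proof. by apply/eqP/eqP => [/eq0_normc//|->]; apply: normc0. Qed.

Lemma cabs2E z : cabs2 z = normc z ^+ 2.
Proof. by case: z => a b; rewrite /normc sqr_sqrtr// addr_ge0// sqr_ge0. Qed.

Lemma normcB z c : normc (z - c) = normc (c - z).
Proof. by rewrite -opprB; apply: normcN. Qed.

Definition vnorm u := Num.sqrt (normc u.1 ^+ 2 + normc u.2 ^+ 2).
Definition wedge u v := u.1 * v.2 - u.2 * v.1.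
Definition vscale c u : vec := (c * u.1, c * u.2).

Lemma vnorm_sqr u : vnorm u ^+ 2 = normc u.1 ^+ 2 + normc u.2 ^+ 2.
Proof. by rewrite sqr_sqrtr// addr_ge0// sqr_ge0. Qed.

Lemma vnorm_ge0 u : 0 <= vnorm u. Proof. exact: sqrtr_ge0. Qed.

Lemma vnorm_eq0 u : (vnorm u == 0) = (u == 0).
Proof.
rewrite sqrtr_eq0 le_eqVlt ltNge addr_ge0 ?sqr_ge0// orbF.
rewrite paddr_eq0 ?sqr_ge0// !sqrf_eq0 !normc_eq0.
by case: u => a b; rewrite xpair_eqE.
Qed.

Lemma vnorm_gt0 u : (0 < vnorm u) = (u != 0).
Proof. by rewrite lt_def vnorm_ge0 andbT vnorm_eq0. Qed.

Lemma vnorm_scale c u : vnorm (vscale c u) = normc c * vnorm u.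
Proof.
rewrite /vnorm /= !normcM !exprMn -mulrDr sqrtrM ?sqr_ge0//.
by rewrite sqrtr_sqr ger0_norm// normc_ge0.
Qed.

Lemma wedge_scale c u v : wedge (vscale c u) v = c * wedge u v.
Proof. by rewrite /wedge/=; ring. Qed.

Lemma wedgeC u v : wedge u v = - wedge v u.
Proof. by rewrite /wedge; ring. Qed.

Lemma wedge_normC u v : normc (wedge u v) = normc (wedge v u).
Proof. by rewrite wedgeC; apply: normcN. Qed.

Lemma cauchy_schwarz2 (a b c d : R) :
  a * c + b * d <= Num.sqrt (a ^+ 2 + b ^+ 2) * Num.sqrt (c ^+ 2 + d ^+ 2).
Proof.
rewrite -sqrtrM ?addr_ge0 ?sqr_ge0//.
apply: le_trans (ler_norm _) _; rewrite -sqrtr_sqr ler_sqrt.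
  by have := sqr_ge0 (a * d - b * c); nra.
by rewrite mulr_ge0 ?addr_ge0 ?sqr_ge0.
Qed.

Lemma wedge_le u v : normc (wedge u v) <= vnorm u * vnorm v.
Proof.
apply: le_trans (le_normcD _ _) _; rewrite normcN !normcM.
have := cauchy_schwarz2 (normc u.1) (normc u.2) (normc v.2) (normc v.1).
by rewrite (addrC (normc v.2 ^+ 2)).
Qed.

Lemma vnormD u v : vnorm (u + v) <= vnorm u + vnorm v.
Proof.
have s0 : 0 <= vnorm u + vnorm v by rewrite addr_ge0 ?vnorm_ge0.
rewrite -(ler_pXn2r (n := 2)) ?nnegrE ?vnorm_ge0// vnorm_sqr sqrrD !vnorm_sqr/=.
have h1 := le_normcD u.1 v.1; have h2 := le_normcD u.2 v.2.
have := cauchy_schwarz2 (normc u.1) (normc u.2) (normc v.1) (normc v.2).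
rewrite -/(vnorm u) -/(vnorm v).
have k1 : normc (u.1 + v.1) ^+ 2 <= (normc u.1 + normc v.1) ^+ 2.
  by rewrite ler_pXn2r// nnegrE ?addr_ge0 ?normc_ge0.
have k2 : normc (u.2 + v.2) ^+ 2 <= (normc u.2 + normc v.2) ^+ 2.
  by rewrite ler_pXn2r// nnegrE ?addr_ge0 ?normc_ge0.
rewrite !sqrrD in k1 k2; lra.
Qed.

Lemma vnormN u : vnorm (- u) = vnorm u.
Proof. by rewrite /vnorm/= !normcN. Qed.

Lemma vnormB u v : vnorm (u - v) = vnorm (v - u).
Proof. by rewrite -opprB vnormN. Qed.

Lemma vnorm_dist u v : `|vnorm u - vnorm v| <= vnorm (u - v).
Proof.
have := vnormD (u - v) v; have := vnormD (v - u) u; rewrite !subrK.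
by rewrite (vnormB v u) ler_norml => *; apply/andP; split; lra.
Qed.

(* The three vectors [(u ^ w) v], [(u ^ v) w], [(v ^ w) u] of a plane are
   dependent, the first being the sum of the other two. *)
Lemma wedge_tri u v w :
  normc (wedge u w) * vnorm v <=
  normc (wedge u v) * vnorm w + normc (wedge v w) * vnorm u.
Proof.
rewrite -!vnorm_scale; apply: le_trans (vnormD _ _).
rewrite le_eqVlt; apply/orP; left; apply/eqP; congr vnorm.
by rewrite /vscale /wedge; congr (_, _) => /=; ring.
Qed.

(** The projective class of [u], with [(1, 0)] standing for infinity; the zero vector falls on
    infinity by default. *)
Definition pt u : sphere R := if u.2 == 0 then None else Some (u.1 / u.2).
Definition rep x : vec := if x is Some z then (z, 1) else (1, 0).

Lemma rep_neq0 x : rep x != 0.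
Proof. by case: x => [z|]; rewrite xpair_eqE oner_eq0 ?andbF. Qed.

Lemma pt_rep x : pt (rep x) = x.
Proof. by case: x => [z|]; rewrite /pt/= ?eqxx ?oner_eq0 ?divr1. Qed.

Lemma pt_scale c u : c != 0 -> pt (vscale c u) = pt u.
Proof.
move=> c0; rewrite /pt/= mulf_eq0 (negbTE c0)/=; case: eqP => // _.
by rewrite -mulf_div divff// mul1r.
Qed.

Lemma rep_pt u : u != 0 -> exists2 c, c != 0 & u = vscale c (rep (pt u)).
Proof.
case: u => a b; rewrite xpair_eqE negb_and /pt/= => h; case: (eqVneq b 0) h => [->|b0] h.
  exists a; first by rewrite orbF in h.
  by rewrite /vscale/= mulr1 mulr0.
by exists b => //; rewrite /vscale/= mulr1 mulrC divfK.
Qed.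

(** The chordal distance is twice the sine of the angle between the complex lines spanned by the two
    vectors. *)
Lemma sdist_rep x y :
  sdist x y = 2 * normc (wedge (rep x) (rep y)) / (vnorm (rep x) * vnorm (rep y)).
Proof.
have v1 z : vnorm (z, 1) = Num.sqrt (1 + cabs2 z).
  by rewrite /vnorm [(z, 1).2]/(1 : C) normc1 expr1n addrC cabs2E.
have v0 : vnorm (1, 0) = 1.
  by rewrite /vnorm [(1, 0).2]/(0 : C) normc0 normc1 expr1n expr0n addr0 sqrtr1.
have s2 z : Num.sqrt (cabs2 z) = normc z.
  by rewrite cabs2E sqrtr_sqr ger0_norm// normc_ge0.
case: x y => [z|] [t|]; rewrite /sdist /rep ?v1 ?v0 ?mulr1 ?mul1r.
- have -> : wedge (z, 1) (t, 1) = z - t by rewrite /wedge/= mulr1 mul1r.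
  by rewrite s2 sqrtrM// addr_ge0// cabs2E sqr_ge0.
- have -> : wedge (z, 1) (1, 0) = - 1 by rewrite /wedge/= mulr0 mulr1 sub0r.
  by rewrite normcN normc1 mulr1.
- have -> : wedge (1, 0) (t, 1) = 1 by rewrite /wedge/= mulr1 mul0r subr0.
  by rewrite normc1 mulr1.
- have -> : wedge (1, 0) (1, 0) = 0 by rewrite /wedge/= mulr0 mul0r subr0.
  by rewrite normc0 mulr0 mul0r.
Qed.

Lemma sdist_pt u v : u != 0 -> v != 0 ->
  sdist (pt u) (pt v) = 2 * normc (wedge u v) / (vnorm u * vnorm v).
Proof.
move=> /rep_pt[c c0 uE] /rep_pt[t t0 vE]; rewrite sdist_rep.
rewrite [in RHS]uE [in RHS]vE !vnorm_scale wedge_scale wedge_normC.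
rewrite normcM (wedge_normC _ (vscale _ _)) wedge_scale normcM.
rewrite (wedge_normC (rep (pt v))).
have := rep_neq0 (pt u); rewrite -vnorm_eq0 => ru.
have := rep_neq0 (pt v); rewrite -vnorm_eq0 => rv.
by field; rewrite ru rv !normc_eq0 c0 t0.
Qed.

Lemma pt_unit x : exists2 u, vnorm u = 1 & pt u = x.
Proof.
pose c : C := ((vnorm (rep x))^-1 +i* 0)%C.
have r0 : 0 < vnorm (rep x) by rewrite vnorm_gt0 rep_neq0.
have nc : normc c = (vnorm (rep x))^-1.
  by rewrite /normc/= expr0n addr0 sqrtr_sqr ger0_norm// invr_ge0 ltW.
exists (vscale c (rep x)); first by rewrite vnorm_scale nc mulVf// gt_eqF.
by rewrite pt_scale ?pt_rep// -normc_eq0 nc invr_eq0 gt_eqF.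
Qed.

Lemma unit_neq0 u : vnorm u = 1 -> u != 0.
Proof. by move=> u1; rewrite -vnorm_eq0 u1 oner_eq0. Qed.

Lemma sdist_unit u v : vnorm u = 1 -> vnorm v = 1 ->
  sdist (pt u) (pt v) = 2 * normc (wedge u v).
Proof.
by move=> u1 v1; rewrite sdist_pt ?unit_neq0// u1 v1 mulr1 divr1.
Qed.

Lemma sdist_ge0 x y : 0 <= sdist x y.
Proof.
by rewrite sdist_rep divr_ge0 ?mulr_ge0 ?normc_ge0 ?vnorm_ge0.
Qed.

Lemma sdist_sym x y : sdist x y = sdist y x.
Proof. by rewrite !sdist_rep wedge_normC [vnorm _ * _]mulrC. Qed.

Lemma sdist_le2 x y : sdist x y <= 2.
Proof.
have [u u1 <-] := pt_unit x; have [v v1 <-] := pt_unit y.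
rewrite sdist_unit//; have := wedge_le u v; rewrite u1 v1; lra.
Qed.

Lemma sdist_tri y x t : sdist x t <= sdist x y + sdist y t.
Proof.
have [u u1 <-] := pt_unit x; have [v v1 <-] := pt_unit y; have [w w1 <-] := pt_unit t.
by rewrite !sdist_unit//; have := wedge_tri u v w; rewrite u1 v1 w1; lra.
Qed.

Lemma sdist_self x : sdist x x = 0.
Proof.
have w0 : wedge (rep x) (rep x) = 0 by rewrite /wedge mulrC subrr.
by rewrite sdist_rep w0 normc0 mulr0 mul0r.
Qed.

Lemma wedge_eq0 u v : u != 0 -> v != 0 -> wedge u v = 0 -> pt u = pt v.
Proof.
case: u v => a b [c d]; rewrite !xpair_eqE !negb_and /pt /wedge/=.
move=> u0 v0 /eqP; rewrite subr_eq0 => /eqP h.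
case: (eqVneq b 0) u0 h => [->|b0] u0 h; case: (eqVneq d 0) v0 h => [->|d0] v0 h//.
- rewrite mul0r in h; move: u0; rewrite orbF => a0.
  by move/eqP: h; rewrite mulf_eq0 (negbTE a0) (negbTE d0).
- rewrite mulr0 in h; move: v0; rewrite orbF => c0.
  by move/eqP: h; rewrite eq_sym mulf_eq0 (negbTE b0) (negbTE c0).
- by congr Some; apply/eqP; rewrite eqr_div// h mulrC.
Qed.

Lemma sdist_eq0 x y : sdist x y = 0 -> x = y.
Proof.
have [u u1 <-] := pt_unit x; have [v v1 <-] := pt_unit y.
rewrite sdist_unit// => h; apply: wedge_eq0; rewrite ?unit_neq0//.
by apply/eqP; rewrite -normc_eq0; apply/eqP; lra.
Qed.

(* [c] is the phase of the Hermitian product [<u, v>]; Lagrange's identity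
   gives [|<u, v>|^2 + |u ^ v|^2 = 1]. *)
Lemma align_phase u v : vnorm u = 1 -> vnorm v = 1 ->
  exists2 c, normc c = 1 & vnorm (u - vscale c v) <= sdist (pt u) (pt v).
Proof.
move=> u1 v1; rewrite sdist_unit//.
pose s : C := u.1 * conjc v.1 + u.2 * conjc v.2.
pose n := normc s.
have U : vnorm u ^+ 2 = 1 by rewrite u1 expr1n.
have V : vnorm v ^+ 2 = 1 by rewrite v1 expr1n.
rewrite vnorm_sqr -!cabs2E in U; rewrite vnorm_sqr -!cabs2E in V.
have lagrange : n ^+ 2 + normc (wedge u v) ^+ 2 = 1.
  rewrite /n -!cabs2E -[RHS]mulr1 -{1}U -V /s /wedge.
  case: (u) => [[a a'] [b b']]; case: (v) => [[c c'] [e e']].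
  by rewrite /cabs2; simpc => /=; ring.
have n0 : 0 <= n := normc_ge0 s.
have [c c1 cs] : exists2 c, normc c = 1 & complex.Re (conjc c * s) = n.
  have [s0|s0] := eqVneq s 0.
    exists 1; first exact: normc1.
    by rewrite /n s0 mulr0 normc0.
  have nn : n != 0 by rewrite /n normc_eq0.
  exists (s * (n^-1 +i* 0)%C).
    rewrite normcM -/n /normc/= expr0n addr0 sqrtr_sqr ger0_norm ?divff//.
    by rewrite invr_ge0.
  have : cabs2 s = n ^+ 2 by rewrite cabs2E.
  case: (s) => a b; rewrite /cabs2; simpc => /= h.
  have -> : a / n * a + b / n * b = n ^+ 2 / n by rewrite -h; ring.
  by rewrite expr2 mulfK.
exists c => //.
have w0 := normc_ge0 (wedge u v).
have c2 : cabs2 c = 1 by rewrite cabs2E c1 expr1n.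
have key : vnorm (u - vscale c v) ^+ 2 = 2 - 2 * n.
  transitivity (cabs2 u.1 + cabs2 u.2 + cabs2 c * (cabs2 v.1 + cabs2 v.2) - 2 * n).
    rewrite vnorm_sqr -!cabs2E -cs /s.
    case: (u) => [[a a'] [b b']]; case: (v) => [[k k'] [e e']]; case: (c) => [p q].
    by rewrite /vscale /cabs2; simpc => /=; ring.
  by rewrite U V c2; lra.
(* The squared claim is [2 - 2 n <= 4 (1 - n) (1 + n)], true because [0 <= n <= 1]. *)
rewrite -(ler_pXn2r (n := 2)) ?nnegrE ?vnorm_ge0 ?mulr_ge0// key.
by rewrite exprMn; have : n <= 1; nra.
Qed.

End Vectors.

(** * Sequential compactness of the sphere *)

Section Compactness.
Variable R : realType.
Implicit Types e : R.

Lemma square_cluster (f : nat -> (R * R) * (R * R)) :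
  (forall k, [/\ `|(f k).1.1| <= 1, `|(f k).1.2| <= 1,
                `|(f k).2.1| <= 1 & `|(f k).2.2| <= 1]) ->
  exists p : (R * R) * (R * R), forall e m, 0 < e -> exists2 k, (m <= k)%N &
    [/\ `|p.1.1 - (f k).1.1| < e, `|p.1.2 - (f k).1.2| < e,
        `|p.2.1 - (f k).2.1| < e & `|p.2.2 - (f k).2.2| < e].
Proof.
move=> f1.
have K := compact_setX (compact_setX (@segment_compact R (-1) 1) (@segment_compact R (-1) 1))
  (compact_setX (@segment_compact R (-1) 1) (@segment_compact R (-1) 1)).
have [|p [_ hp]] := K (f @ \oo) _.
  exists 0%N => // k _; have [a b c d] := f1 k.
  by split; split; rewrite /= in_itv/= -ler_norml.
exists p => e m e0.
have A : (f @ \oo) (f @` [set k | (m <= k)%N]) by exists m => // k mk; exists k.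
have [_ [[k mk <-] [[a b] [c d]]]] := hp _ _ A (nbhsx_ballx p e e0).
by exists k.
Qed.

Local Notation vec := (R[i] * R[i])%type.

(** Unit representatives live in a compact cube; their cluster vector is again a unit vector, and on
    unit vectors [sdist] is at most twice the norm of the difference. *)
Lemma sdist_cluster (x : nat -> sphere R) :
  exists a, forall e m, 0 < e -> exists2 k, (m <= k)%N & sdist a (x k) < e.
Proof.
have /choice[u hu] k : exists u : vec, vnorm u = 1 /\ pt u = x k.
  by have [u u1 ux] := pt_unit (x k); exists u.
pose f k := ((complex.Re (u k).1, complex.Im (u k).1), (complex.Re (u k).2, complex.Im (u k).2)).
have sq1 (a b : R) : a ^+ 2 + b = 1 -> 0 <= b -> `|a| <= 1.
  by move=> ab b0; rewrite ler_norml; apply/andP; split; nra.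
have [|p hp] := @square_cluster f.
  move=> k; have [+ _] := hu k => /(congr1 (fun r => r ^+ 2)).
  rewrite vnorm_sqr -!cabs2E expr1n /cabs2 /f/= => h.
  split; [apply: (sq1 _ (complex.Im (u k).1 ^+ 2 + (complex.Re (u k).2 ^+ 2 + complex.Im (u k).2 ^+ 2)))
         |apply: (sq1 _ (complex.Re (u k).1 ^+ 2 + (complex.Re (u k).2 ^+ 2 + complex.Im (u k).2 ^+ 2)))
         |apply: (sq1 _ (complex.Im (u k).2 ^+ 2 + (complex.Re (u k).1 ^+ 2 + complex.Im (u k).1 ^+ 2)))
         |apply: (sq1 _ (complex.Re (u k).2 ^+ 2 + (complex.Re (u k).1 ^+ 2 + complex.Im (u k).1 ^+ 2)))];
  rewrite ?addr_ge0 ?sqr_ge0//; lra.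
pose w : vec := ((p.1.1 +i* p.1.2)%C, (p.2.1 +i* p.2.2)%C).
have near e m : 0 < e -> exists2 k, (m <= k)%N & vnorm (w - u k) < e.
  move=> e0; have e20 : 0 < e / 2 by rewrite divr_gt0.
  have [k mk [a b c d]] := hp _ m e20; exists k => //.
  rewrite -(ltr_pXn2r (n := 2)) ?nnegrE ?vnorm_ge0 ?(ltW e0)//.
  have sq (r : R) : `|r| < e / 2 -> r ^+ 2 < (e / 2) ^+ 2.
    by move=> re; rewrite -[r ^+ 2]real_normK ?num_real// ltr_pXn2r// nnegrE// ltW.
  move/sq: a; move/sq: b; move/sq: c; move/sq: d.
  rewrite vnorm_sqr -!cabs2E /cabs2 /w /f/=.
  by case: (u k) => [[? ?] [? ?]] /=; lra.
have w1 : vnorm w = 1.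
  apply/eqP/negP => /negP; rewrite -subr_eq0 -normr_gt0 => /(near _ 0%N)[k _ wk].
  by have := vnorm_dist w (u k); have [-> _] := hu k; rewrite leNgt wk.
exists (pt w) => e m e0.
have e20 : 0 < e / 2 by rewrite divr_gt0.
have [k mk ke] := near _ m e20; exists k => //.
have [uk1 <-] := hu k; rewrite sdist_unit//.
have -> : wedge w (u k) = wedge (w - u k) (u k) by rewrite /wedge/=; ring.
by have := wedge_le (w - u k) (u k); rewrite uk1 mulr1; lra.
Qed.

End Compactness.

(** * Rational maps in homogeneous coordinates *)

Section BoundedLipschitz.
Variable R : realType.
Local Notation C := R[i].
Local Notation vec := (C * C)%type.
Implicit Types (u v : vec) (g h : vec -> vec -> C).

(** The bound is carried along with the Lipschitz constant so that the class is stable under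
    products and hence contains all polynomials in the coordinates. *)
Definition bounded_lipschitz g := exists2 A : R, 0 <= A &
  forall u v u' v', vnorm u <= 1 -> vnorm v <= 1 -> vnorm u' <= 1 -> vnorm v' <= 1 ->
  normc (g u v) <= A /\
  normc (g u v - g u' v') <= A * (vnorm (u - u') + vnorm (v - v')).

Lemma bl_ext g h : (forall u v, g u v = h u v) -> bounded_lipschitz h -> bounded_lipschitz g.
Proof. by move=> gh [A A0 hA]; exists A => // u v u' v'; rewrite !gh; apply: hA. Qed.

Lemma normc_le1 u : normc u.1 <= vnorm u.
Proof.
rewrite -(ler_pXn2r (n := 2)) ?nnegrE ?vnorm_ge0 ?normc_ge0//.
by rewrite vnorm_sqr lerDl sqr_ge0.
Qed.

Lemma normc_le2 u : normc u.2 <= vnorm u.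
Proof.
rewrite -(ler_pXn2r (n := 2)) ?nnegrE ?vnorm_ge0 ?normc_ge0//.
by rewrite vnorm_sqr lerDr sqr_ge0.
Qed.

Lemma bl_cst (c : C) : bounded_lipschitz (fun _ _ => c).
Proof.
exists (normc c); first exact: normc_ge0.
by move=> *; rewrite subrr normc0 mulr_ge0 ?addr_ge0 ?normc_ge0 ?vnorm_ge0.
Qed.

Lemma bl_coord : [/\ bounded_lipschitz (fun u _ => u.1), bounded_lipschitz (fun u _ => u.2),
  bounded_lipschitz (fun _ v => v.1) & bounded_lipschitz (fun _ v => v.2)].
Proof.
split; exists 1 => // u v u' v' u1 v1 u'1 v'1; rewrite mul1r; split.
- exact: le_trans (normc_le1 _) u1.
- by apply: le_trans (normc_le1 (u - u')) _; rewrite lerDl vnorm_ge0.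
- exact: le_trans (normc_le2 _) u1.
- by apply: le_trans (normc_le2 (u - u')) _; rewrite lerDl vnorm_ge0.
- exact: le_trans (normc_le1 _) v1.
- by apply: le_trans (normc_le1 (v - v')) _; rewrite lerDr vnorm_ge0.
- exact: le_trans (normc_le2 _) v1.
- by apply: le_trans (normc_le2 (v - v')) _; rewrite lerDr vnorm_ge0.
Qed.

Lemma bl_add g h : bounded_lipschitz g -> bounded_lipschitz h ->
  bounded_lipschitz (fun u v => g u v + h u v).
Proof.
move=> [A A0 hA] [B B0 hB]; exists (A + B); first exact: addr_ge0.
move=> u v u' v' u1 v1 u'1 v'1.
have [a1 a2] := hA _ _ _ _ u1 v1 u'1 v'1; have [b1 b2] := hB _ _ _ _ u1 v1 u'1 v'1.
split; first by apply: le_trans (le_normcD _ _) _; apply: lerD.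
have -> : g u v + h u v - (g u' v' + h u' v') = (g u v - g u' v') + (h u v - h u' v') by ring.
by apply: le_trans (le_normcD _ _) _; rewrite mulrDl lerD.
Qed.

Lemma bl_mul g h : bounded_lipschitz g -> bounded_lipschitz h ->
  bounded_lipschitz (fun u v => g u v * h u v).
Proof.
move=> [A A0 hA] [B B0 hB]; exists (A * B + A * B); first by rewrite addr_ge0 ?mulr_ge0.
move=> u v u' v' u1 v1 u'1 v'1.
have [a1 a2] := hA _ _ _ _ u1 v1 u'1 v'1; have [b1 b2] := hB _ _ _ _ u1 v1 u'1 v'1.
have [b3 _] := hB _ _ _ _ u'1 v'1 u1 v1.
have AB : 0 <= A * B by rewrite mulr_ge0.
split.
  rewrite normcM; apply: le_trans (ler_pM (normc_ge0 _) (normc_ge0 _) a1 b1) _.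
  by rewrite lerDl.
have -> : g u v * h u v - g u' v' * h u' v' =
  g u v * (h u v - h u' v') + (g u v - g u' v') * h u' v' by ring.
apply: le_trans (le_normcD _ _) _; rewrite !normcM mulrDl lerD//.
  by rewrite -mulrA; apply: ler_pM; rewrite ?normc_ge0.
by rewrite mulrAC; apply: ler_pM; rewrite ?normc_ge0.
Qed.

Lemma bl_exp g n : bounded_lipschitz g -> bounded_lipschitz (fun u v => g u v ^+ n).
Proof.
move=> gl; elim: n => [|n IH]; first exact: bl_cst 1.
by apply: (@bl_ext _ (fun u v => g u v * g u v ^+ n)); [move=> u v; rewrite exprS|exact: bl_mul].
Qed.

Lemma bl_sum (I : Type) (r : seq I) (g : I -> vec -> vec -> C) :
  (forall i, bounded_lipschitz (g i)) -> bounded_lipschitz (fun u v => \sum_(i <- r) g i u v).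
Proof.
move=> gl; elim: r => [|i r IH].
  by apply: (bl_ext _ (bl_cst 0)) => u v; rewrite big_nil.
by apply: (bl_ext _ (bl_add (gl i) IH)) => u v; rewrite big_cons.
Qed.

Lemma bl_opp g : bounded_lipschitz g -> bounded_lipschitz (fun u v => - g u v).
Proof.
move=> gl; apply: (bl_ext _ (bl_mul (bl_cst (-1)) gl)) => u v.
by rewrite mulN1r.
Qed.

(** Once the common monomial is taken out, a difference of the [(i - j)]-th powers of [u.1 * v.2]
    and [u.2 * v.1] remains, divisible by their difference [wedge u v]. *)
Lemma monomial_bracket (D i j : nat) : (i <= D)%N -> (j <= D)%N ->
  exists2 h, bounded_lipschitz h & forall u v,
    u.1 ^+ i * u.2 ^+ (D - i) * (v.1 ^+ j * v.2 ^+ (D - j)) -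
    v.1 ^+ i * v.2 ^+ (D - i) * (u.1 ^+ j * u.2 ^+ (D - j)) = wedge u v * h u v.
Proof.
wlog ji : i j / (j <= i)%N.
  move=> H iD jD; case/orP: (leq_total j i) => [ji|ij]; first exact: H.
  have [h hl hE] := H _ _ ij jD iD; exists (fun u v => - h u v); first exact: bl_opp.
  by move=> u v; rewrite mulrN -hE; ring.
move=> iD _; have [l1 l2 l3 l4] := bl_coord.
exists (fun u v => (u.2 * v.2) ^+ (D - i) * (u.1 * v.1) ^+ j *
   \sum_(k < (i - j)%N) (u.1 * v.2) ^+ ((i - j).-1 - k) * (u.2 * v.1) ^+ k).
  apply: bl_mul; first by apply: bl_mul; apply/bl_exp/bl_mul.
  by apply: bl_sum => k; apply: bl_mul; apply/bl_exp/bl_mul.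
move=> u v; rewrite [RHS]mulrCA /wedge -subrXX.
have -> : (D - j = (D - i) + (i - j))%N by rewrite addnBA// subnK.
have iE : i = (i - j + j)%N by rewrite subnK.
move: (D - i)%N (i - j)%N iE => f e ->.
by rewrite !exprMn !exprD; ring.
Qed.

End BoundedLipschitz.

(** * The lift of a rational map: conformality and openness *)

Section HomogeneousLift.
Variables (R : realType) (p q : {poly R[i]}).
Local Notation C := R[i].
Local Notation vec := (C * C)%type.
Local Notation T := (rat_map p q).
Local Notation D := (rat_degree p q).
Implicit Types (f : {poly C}) (u v w : vec) (z c : C) (x y : sphere R).
Hypothesis pq : coprimep p q.
Hypothesis deg_gt0 : (0 < D)%N.

Definition form (f : {poly C}) (u : vec) : C :=
  \sum_(i < D.+1) f`_i * (u.1 ^+ i * u.2 ^+ (D - i)).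
Definition lift (u : vec) : vec := (form p u, form q u).

Lemma form_scale f c u : form f (vscale c u) = c ^+ D * form f u.
Proof.
rewrite /form mulr_sumr; apply: eq_bigr => i _ /=.
have -> : c ^+ D = c ^+ i * c ^+ (D - i) by rewrite -exprD subnKC// -ltnS.
by rewrite !exprMn; ring.
Qed.

Lemma lift_scale c u : lift (vscale c u) = vscale (c ^+ D) (lift u).
Proof. by rewrite /lift !form_scale. Qed.

Lemma form_finite f z : (size f <= D.+1)%N -> form f (z, 1) = f.[z].
Proof.
move=> fD; rewrite (horner_coef_wide _ fD); apply: eq_bigr => i _ /=.
by rewrite expr1n mulr1.
Qed.

Lemma form_infty f : form f (1, 0) = f`_D.
Proof.
rewrite /form big_ord_recr/= subnn expr0 expr1n !mulr1 big1 ?add0r// => i _.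
by rewrite expr0n subn_eq0 leqNgt ltn_ord/= !mulr0.
Qed.

Lemma size_leS (f : {poly C}) : (degp f <= D)%N -> (size f <= D.+1)%N.
Proof. by rewrite /degp; case: (size f). Qed.

Lemma size_num : (size p <= D.+1)%N. Proof. exact/size_leS/leq_maxl. Qed.
Lemma size_den : (size q <= D.+1)%N. Proof. exact/size_leS/leq_maxr. Qed.

Lemma form_infty_lead f : (degp f <= D)%N ->
  form f (1, 0) = if degp f == D then lead_coef f else 0.
Proof.
rewrite form_infty leq_eqVlt; case: eqVneq => [<-|]//= _ fD.
by rewrite nth_default//; move: fD; rewrite /degp; case: (size f).
Qed.

Lemma lead_neq0 (f : {poly C}) : degp f = D -> lead_coef f != 0.
Proof.
move=> fD; rewrite lead_coef_eq0; apply/eqP => f0.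
by move: deg_gt0; rewrite -fD f0 /degp size_poly0.
Qed.

(** Coprimality excludes a common zero at finite points; at infinity, whichever of [p], [q] has full
    degree contributes its leading coefficient. *)
Lemma rat_map_rep x : lift (rep x) != 0 /\ T x = pt (lift (rep x)).
Proof.
case: x => [z|] /=.
  rewrite /lift !form_finite ?size_num ?size_den// xpair_eqE negb_and /pt/=.
  case: (eqVneq q.[z] 0) => [qz|qz]; rewrite ?orbT//= orbF; split => //.
  apply/eqP => pz; have /coprimep_root : coprimep p q by [].
  by move=> /(_ z); rewrite /root pz eqxx => /(_ isT); rewrite qz eqxx.
rewrite /lift !form_infty_lead ?leq_maxl ?leq_maxr// xpair_eqE negb_and /pt/=.
have DE : D = maxn (degp p) (degp q) by [].
case: (ltngtP (degp p) (degp q)) DE => h DE.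
- have Dq : D = degp q by exact: DE.
  have lq := lead_neq0 (esym Dq).
  by rewrite Dq eqxx (ltn_eqF h) lq orbT (negbTE lq) mul0r.
- have Dp : D = degp p by exact: DE.
  have lp := lead_neq0 (esym Dp).
  by rewrite Dp eqxx (ltn_eqF h) lp eqxx.
- have Dq : D = degp q by rewrite DE ?h ?maxnn.
  have lq := lead_neq0 (esym Dq).
  by rewrite Dq h eqxx lq orbT (negbTE lq).
Qed.

Lemma rat_map_pt u : u != 0 -> lift u != 0 /\ T (pt u) = pt (lift u).
Proof.
move=> /rep_pt[c c0 ->]; rewrite pt_scale// pt_rep lift_scale.
have [l0 TE] := rat_map_rep (pt u); have cD : c ^+ D != 0 by rewrite expf_neq0.
split; last by rewrite pt_scale.
by rewrite -vnorm_eq0 vnorm_scale mulf_eq0 normc_eq0 vnorm_eq0 (negbTE cD).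
Qed.

Lemma bl_form f : bounded_lipschitz (fun u _ => form f u).
Proof.
have [l1 l2 _ _] := bl_coord R.
apply: bl_sum => i; apply: bl_mul; first exact: bl_cst.
by apply: bl_mul; apply: bl_exp.
Qed.

Lemma vnorm_le_sum (u : vec) : vnorm u <= normc u.1 + normc u.2.
Proof.
have n1 := normc_ge0 u.1; have n2 := normc_ge0 u.2.
rewrite -(ler_pXn2r (n := 2)) ?nnegrE ?vnorm_ge0 ?addr_ge0// vnorm_sqr.
by have := mulr_ge0 n1 n2; nra.
Qed.

Lemma lift_lipschitz : exists2 A : R, 0 <= A & forall u u', vnorm u <= 1 -> vnorm u' <= 1 ->
  vnorm (lift u) <= A /\ vnorm (lift u - lift u') <= A * vnorm (u - u').
Proof.
have [A A0 hA] := bl_form p; have [B B0 hB] := bl_form q.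
exists (A + B); first exact: addr_ge0.
move=> u u' u1 u'1; have [a1 a2] := hA _ _ _ _ u1 u1 u'1 u1.
have [b1 b2] := hB _ _ _ _ u1 u1 u'1 u1.
have v0 : vnorm (u - u) = 0 by apply/eqP; rewrite vnorm_eq0 subrr.
rewrite v0 addr0 in a2 b2; split; apply: le_trans (vnorm_le_sum _) _.
  by rewrite lerD.
by rewrite mulrDl lerD.
Qed.

Lemma lift_bracket : exists2 H, bounded_lipschitz H &
  forall u v, wedge (lift u) (lift v) = wedge u v * H u v.
Proof.
have /choice[h hP] (ij : 'I_D.+1 * 'I_D.+1) : exists h, bounded_lipschitz h /\ forall u v : vec,
    u.1 ^+ ij.1 * u.2 ^+ (D - ij.1) * (v.1 ^+ ij.2 * v.2 ^+ (D - ij.2)) -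
    v.1 ^+ ij.1 * v.2 ^+ (D - ij.1) * (u.1 ^+ ij.2 * u.2 ^+ (D - ij.2)) = wedge u v * h u v.
  have [h hl hE] := @monomial_bracket R D ij.1 ij.2 (ltn_ord ij.1) (ltn_ord ij.2).
  by exists h.
exists (fun u v => \sum_(i < D.+1) \sum_(j < D.+1) p`_i * q`_j * h (i, j) u v).
  apply: bl_sum => i; apply: bl_sum => j; apply: bl_mul; first exact: bl_cst.
  by case: (hP (i, j)).
move=> u v; rewrite /wedge /lift /form/= (mulrC (\sum_(_ < _) q`_ _ * _)).
rewrite !mulr_suml -sumrB mulr_sumr; apply: eq_bigr => i _.
rewrite !mulr_sumr -sumrB; apply: eq_bigr => j _.
have [_ /(_ u v) hE] := hP (i, j); rewrite /wedge/= in hE.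
by rewrite [RHS]mulrCA -hE; ring.
Qed.

(** Compactness: if [lift] became arbitrarily small on unit vectors, it would vanish at a cluster
    vector [w]. Convergence holds only up to a phase, which does not change the norm of [lift]. *)
Lemma lift_lower : exists2 m : R, 0 < m & forall u, vnorm u = 1 -> m <= vnorm (lift u).
Proof.
have [A A0 hA] := lift_lipschitz.
apply: contrapT => nm.
have /choice[u hu] k : exists u : vec, vnorm u = 1 /\ vnorm (lift u) < k.+1%:R^-1.
  apply: contrapT => nu; apply: nm; exists k.+1%:R^-1; first by rewrite invr_gt0.
  by move=> u u1; rewrite leNgt; apply/negP => h; apply: nu; exists u.
have [a ha] := sdist_cluster (fun k => pt (u k)).
have [w w1 wa] := pt_unit a.
have [lw0 _] := rat_map_pt (unit_neq0 w1).
have l0 : 0 < vnorm (lift w) by rewrite vnorm_gt0.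
pose e := vnorm (lift w) / 2 / (A + 1).
have e0 : 0 < e by rewrite !divr_gt0// ltr_wpDl.
have [m hm] : exists m : nat, m.+1%:R^-1 < vnorm (lift w) / 2.
  have := @ltr_add_invr R 0 (vnorm (lift w) / 2).
  rewrite divr_gt0// => /(_ isT)[m]; rewrite add0r => hm; by exists m.
have [k mk ak] := ha e m e0; have [uk1 uk] := hu k.
have [c c1 hc] := align_phase w1 uk1; rewrite wa in hc.
have [|| _ h] := hA w (vscale c (u k)); rewrite ?w1 ?vnorm_scale ?c1 ?mul1r ?uk1//.
have lc : vnorm (lift (vscale c (u k))) = vnorm (lift (u k)).
  by rewrite lift_scale vnorm_scale normcX c1 expr1n mul1r.
have := vnorm_dist (lift w) (lift (vscale c (u k))).
rewrite lc ler_distl => /andP[_ h2].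
have h3 : A * vnorm (w - vscale c (u k)) <= A * e.
  by rewrite ler_wpM2l// (le_trans hc)// ltW.
have h4 : A * e <= vnorm (lift w) / 2.
  have A1 : 0 < A + 1 by rewrite ltr_wpDl.
  by rewrite /e mulrA ler_pdivrMr// mulrC ler_wpM2l ?lerDl// divr_ge0// ltW.
have h5 : k.+1%:R^-1 <= m.+1%:R^-1 :> R by rewrite lef_pV2 ?posrE// ler_nat.
have {uk h5 hm} h6 := lt_trans (lt_le_trans uk h5) hm; lra.
Qed.

(** For unit vectors [a], [b] above [x], [y] the exact ratio of distances is
    [|H a b| / (|F a| |F b|)], with [F] the lift. The derivative is its value at [b = a], and since
    all terms are Lipschitz and bounded, replacing [b] by [a] costs a multiple of [sdist x y]. *)
Lemma rat_map_conformal : exists D0 A M, [/\ forall x, 0 <= D0 x <= M, 0 <= A &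
  forall x y, `|sdist (T x) (T y) - D0 x * sdist x y| <= A * sdist x y ^+ 2].
Proof.
have [m m0 hm] := lift_lower; have [A A0 hA] := lift_lipschitz.
have [H [B B0 hB] HE] := lift_bracket.
have /choice[u hu] x : exists u : vec, vnorm u = 1 /\ pt u = x.
  by have [u u1 ux] := pt_unit x; exists u.
have v0 (w : vec) : vnorm (w - w) = 0 by apply/eqP; rewrite vnorm_eq0 subrr.
exists (fun x => normc (H (u x) (u x)) / vnorm (lift (u x)) ^+ 2),
  (2 * (A * B) / m ^+ 3), (B / m ^+ 2); split.
- move=> x; have [u1 _] := hu x; rewrite divr_ge0 ?normc_ge0 ?exprn_ge0 ?vnorm_ge0//=.
  have [||||b _] := hB (u x) (u x) (u x) (u x); rewrite ?u1//.
  apply: ler_pM; rewrite ?normc_ge0 ?invr_ge0 ?exprn_ge0 ?vnorm_ge0//.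
  have l0 : 0 < vnorm (lift (u x)) by apply: lt_le_trans (hm _ u1).
  rewrite lef_pV2 ?posrE ?exprn_gt0// lerXn2r ?nnegrE ?hm// ltW//.
- have m3 : 0 <= m ^+ 3 by rewrite exprn_ge0// ltW.
  by rewrite divr_ge0// !mulr_ge0.
move=> x y; have [a1 ax] := hu x; have [b1 bE] := hu y; set a := u x in a1 ax *.
(* The phase of the vector above [y] is chosen so that it is as close to [a] as [y] is to [x]. *)
have [c c1 hc] := align_phase a1 b1; rewrite ax bE in hc.
set b := vscale c (u y) in hc.
have {}b1 : vnorm b = 1 by rewrite vnorm_scale c1 b1 mulr1.
have {}bE : pt b = y by rewrite pt_scale// -normc_eq0 c1 oner_eq0.
have [la Ta] := rat_map_pt (unit_neq0 a1); have [lb Tb] := rat_map_pt (unit_neq0 b1).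
rewrite ax in Ta; rewrite bE in Tb.
have lam : m <= vnorm (lift a) by apply: hm.
have lbm : m <= vnorm (lift b) by apply: hm.
have -> : sdist (T x) (T y) =
    normc (H a b) / (vnorm (lift a) * vnorm (lift b)) * sdist x y.
  by rewrite Ta Tb sdist_pt// HE normcM -ax -bE sdist_unit//; ring.
have [||||h1 h2] := hB a a a b; rewrite ?a1 ?b1//; rewrite v0 add0r in h2.
have [||||h1' _] := hB a b a b; rewrite ?a1 ?b1//.
have [||k1 k2] := hA a b; rewrite ?a1 ?b1//.
have [||k1' _] := hA b a; rewrite ?a1 ?b1//.
set la' := vnorm (lift a) in lam k1 *; set lb' := vnorm (lift b) in lbm k1' *.
have la0 : 0 < la' by apply: lt_le_trans lam.
have lb0 : 0 < lb' by apply: lt_le_trans lbm.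
have -> : normc (H a b) / (la' * lb') * sdist x y - normc (H a a) / la' ^+ 2 * sdist x y =
   (normc (H a b) * la' - normc (H a a) * lb') / (la' ^+ 2 * lb') * sdist x y.
  by field; rewrite ?gt_eqF.
rewrite normrM (ger0_norm (sdist_ge0 x y)) [sdist x y ^+ 2]expr2 [leRHS]mulrA ler_wpM2r ?sdist_ge0//.
have d0 := sdist_ge0 x y.
have e1 : `|normc (H a b) - normc (H a a)| <= B * sdist x y.
  have dn (z t : C) : `|normc z - normc t| <= normc (z - t).
    have := le_normcD (z - t) t; have := le_normcD (t - z) z; rewrite !subrK.
    by rewrite (normcB t z) ler_norml => *; apply/andP; split; lra.
  apply: le_trans (dn _ _) _; rewrite normcB; apply: le_trans h2 _.
  by rewrite ler_wpM2l.
have e2 : `|la' - lb'| <= A * sdist x y.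
  apply: le_trans (vnorm_dist _ _) _; apply: le_trans k2 _.
  by rewrite ler_wpM2l.
rewrite normrM normfV [`|la' ^+ 2 * lb'|]ger0_norm ?mulr_ge0 ?exprn_ge0 ?(ltW la0) ?(ltW lb0)//.
have -> : normc (H a b) * la' - normc (H a a) * lb' =
   (normc (H a b) - normc (H a a)) * la' + normc (H a a) * (la' - lb') by ring.
have num : `|(normc (H a b) - normc (H a a)) * la' + normc (H a a) * (la' - lb')|
    <= 2 * (A * B) * sdist x y.
  apply: le_trans (ler_normD _ _) _; rewrite !normrM (gtr0_norm la0) (ger0_norm (normc_ge0 _)).
  have f1 := ler_pM (normr_ge0 _) (ltW la0) e1 k1.
  have f2 := ler_pM (normc_ge0 _) (normr_ge0 _) h1 e2.
  lra.
have den : m ^+ 3 <= la' ^+ 2 * lb'.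
  rewrite exprSr; apply: ler_pM; rewrite ?exprn_ge0 ?(ltW m0)//.
  by rewrite lerXn2r ?nnegrE ?(ltW m0) ?(ltW la0).
rewrite [leRHS]mulrAC; apply: ler_pM => //; first by rewrite invr_ge0 mulr_ge0 ?exprn_ge0 ?ltW.
by rewrite lef_pV2 ?posrE ?mulr_gt0 ?exprn_gt0.
Qed.

(** The fundamental theorem of algebra for binary forms: finite roots [z] give [(z, 1)], and the
    missing degree is made up by roots [(1, 0)] at infinity, each contributing a sign. *)
Lemma form_factor f : (size f <= D.+1)%N -> exists k (rs : seq vec),
  [/\ size rs = D, forall r, r \in rs -> r != 0 &
      forall v, form f v = k * \prod_(r <- rs) wedge v r].
Proof.
move=> fD; suff [k [rs [rD r0 hk]]] : exists k (rs : seq vec),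
    [/\ size rs = D, forall r, r \in rs -> r != 0 &
        forall x, form f (rep x) = k * \prod_(r <- rs) wedge (rep x) r].
  exists k, rs; split => // v; have [->|/rep_pt[c c0 ->]] := eqVneq v 0.
    have -> : (0 : vec) = vscale 0 (rep None) by rewrite /vscale !mul0r.
    rewrite form_scale hk; under [in RHS]eq_bigr do rewrite wedge_scale.
    by rewrite big_split/= big_const_seq count_predT rD iter_mulr_1; ring.
  rewrite form_scale hk; under [in RHS]eq_bigr do rewrite wedge_scale.
  by rewrite big_split/= big_const_seq count_predT rD iter_mulr_1; ring.
have one0 : ((1, 0) : vec) != 0 by rewrite xpair_eqE oner_eq0.
have [f0|f0] := eqVneq f 0.
  exists 0, (nseq D (1, 0)); split; rewrite ?size_nseq//; [move=> r|move=> x].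
    by rewrite mem_nseq => /andP[_ /eqP->].
  by rewrite mul0r /form big1// => i _; rewrite f0 coef0 mul0r.
have [rr fE] := closed_field_poly_normal f.
have sf : size f = (size rr).+1.
  by rewrite fE size_scale ?lead_coef_eq0// size_prod_XsubC.
have rD : (size rr <= D)%N by rewrite -ltnS -sf.
exists (lead_coef f * (-1) ^+ (D - size rr)),
  ([seq (z, 1) | z <- rr] ++ nseq (D - size rr) (1, 0)); split.
- by rewrite size_cat size_map size_nseq subnKC.
- move=> r; rewrite mem_cat => /orP[/mapP[z _ ->]|]; first by rewrite xpair_eqE oner_eq0 andbF.
  by rewrite mem_nseq => /andP[_ /eqP->].
move=> x; rewrite big_cat big_map big_nseq iter_mulr_1/=.
case: x => [z|]; rewrite /rep.
  rewrite form_finite// {1}fE hornerZ horner_prod -mulrA; congr (_ * _).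
  have -> : wedge (z, 1) (1, 0) = -1 by rewrite /wedge/= mulr0 sub0r mulr1.
  rewrite mulrCA -exprMn mulrNN mulr1 expr1n mulr1.
  by apply: eq_bigr => t _; rewrite hornerXsubC /wedge/= mulr1 mul1r.
rewrite form_infty big1 ?mul1r; last by move=> t _; rewrite /wedge/= mulr1 mul0r subr0.
rewrite /wedge/= mulr0 mul0r subr0 expr0n subn_eq0.
case: leqP => h; last by rewrite mulr0 nth_default// sf.
have -> : D = size rr by apply/eqP; rewrite eqn_leq h.
by rewrite subnn expr0 !mulr1 lead_coefE sf.
Qed.

(** The roots [r] of the form [wedge (lift v) w] are the preimages of [y']. Its modulus at [x] is
    [K] times the product of the halved distances from [x] to the roots, and it is controlled by
    [sdist (T x) y']; if all roots were [e]-far, this would be bounded below. *)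
Lemma rat_map_open x1 x2 e : T x1 != T x2 -> 0 < e -> exists2 eta : R, 0 < eta &
  forall x y', sdist (T x) y' < eta -> exists2 y, sdist x y < e & T y = y'.
Proof.
move=> x12 e0.
have [m m0 hm] := lift_lower; have [A A0 hA] := lift_lipschitz.
set dl := sdist (T x1) (T x2).
have dl0 : 0 < dl.
  by rewrite lt_def sdist_ge0 andbT; apply: contra x12 => /eqP/sdist_eq0->.
have A1 : 0 < A + 1 by rewrite ltr_wpDl.
have B0 : 0 < m * dl / 4 * (e / 2) ^+ D by rewrite !(mulr_gt0, exprn_gt0, invr_gt0).
exists (m * dl / 4 * (e / 2) ^+ D / (A + 1)); first by rewrite divr_gt0.
move=> x y' xy'; have [w w1 wy] := pt_unit y'.
pose f := w.2 *: p - w.1 *: q.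
have fD : (size f <= D.+1)%N.
  rewrite (leq_trans (size_polyD _ _))// size_polyN geq_max.
  by rewrite !(leq_trans (size_scale_leq _ _)) ?size_num ?size_den.
have fE v : form f v = wedge (lift v) w.
  rewrite /wedge/= /form !mulr_suml -sumrB; apply: eq_bigr => i _.
  by rewrite coefB !coefZ; ring.
have [k [rs [rsD rs0 hk]]] := form_factor fD.
pose K := normc k * \prod_(r <- rs) vnorm r.
have normcP (v : vec) : normc (\prod_(r <- rs) wedge v r) = \prod_(r <- rs) normc (wedge v r).
  by rewrite (big_morph (@normc R) (@normcM R) (@normc1 R)).
have K0 : 0 <= K by rewrite mulr_ge0 ?normc_ge0// prodr_ge0// => r _; apply: vnorm_ge0.
have key v : vnorm v = 1 -> K * \prod_(r <- rs) (sdist (pt v) (pt r) / 2) =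
    vnorm (lift v) * (sdist (T (pt v)) y' / 2).
  move=> v1; have [lv Tv] := rat_map_pt (unit_neq0 v1).
  have -> : vnorm (lift v) * (sdist (T (pt v)) y' / 2) = normc (form f v).
    rewrite fE Tv -wy sdist_pt// ?unit_neq0// w1 mulr1.
    by field; rewrite vnorm_eq0.
  rewrite hk normcM normcP -mulrA -big_split/=; congr (_ * _).
  rewrite big_seq [RHS]big_seq; apply: eq_bigr => r /rs0 r0.
  rewrite (sdist_pt (unit_neq0 v1) r0) v1 mul1r.
  by field; rewrite vnorm_eq0.
(* [K] is bounded below uniformly in [y'], because [T x1] and [T x2] cannot both be closer than
   [dl / 2] to [y']. *)
have Kge : m * dl / 4 <= K.
  have [x0 hx0] : exists x0, dl / 2 <= sdist (T x0) y'.
    case: (lerP (dl / 2) (sdist (T x1) y')) => h1; first by exists x1.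
    exists x2; have := sdist_tri y' (T x1) (T x2); rewrite (sdist_sym y') -/dl; lra.
  have [v v1 vx] := pt_unit x0; have := key v v1; rewrite vx => kv.
  have : K * \prod_(r <- rs) (sdist x0 (pt r) / 2) <= K.
    rewrite ler_piMr// prodr_ile1// => r _.
    by have := sdist_ge0 x0 (pt r); have := sdist_le2 x0 (pt r) => *; apply/andP; split; lra.
  rewrite kv; apply: le_trans.
  have -> : m * dl / 4 = m * (dl / 2 / 2) by field.
  by apply: ler_pM; rewrite ?(ltW m0) ?divr_ge0 ?(ltW dl0) ?hm//; lra.
have [r rrs hr] : exists2 r, r \in rs & sdist x (pt r) < e.
  apply: contrapT => nr.
  have {}nr r : r \in rs -> e <= sdist x (pt r).
    by move=> rrs; rewrite leNgt; apply/negP => h; apply: nr; exists r.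
  have [u u1 ux] := pt_unit x; have := key u u1; rewrite ux.
  have le1 : (e / 2) ^+ D <= \prod_(r <- rs) (sdist x (pt r) / 2).
    rewrite -rsD -[leLHS]mulr1 -(iter_mulr _ _ 1) -(count_predT rs) -big_const_seq.
    rewrite big_seq [leRHS]big_seq; apply: ler_prod => r /nr h.
    by rewrite divr_ge0 ?(ltW e0)//= ler_pM2r// invr_gt0.
  have h1 : m * dl / 4 * (e / 2) ^+ D <= K * \prod_(r <- rs) (sdist x (pt r) / 2).
    by apply: ler_pM => //; rewrite ?exprn_ge0 ?divr_ge0 ?mulr_ge0 ?ltW.
  move=> kE; rewrite kE in h1; move: h1; apply/negP; rewrite -ltNge.
  have [||lA _] := hA u u; rewrite ?u1//.
  move: xy'; rewrite ltr_pdivlMr//; apply: le_lt_trans.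
  have s0 := sdist_ge0 (T x) y'.
  have : vnorm (lift u) * (sdist (T x) y' / 2) <= A * (sdist (T x) y' / 2).
    by rewrite ler_wpM2r ?divr_ge0.
  by have := mulr_ge0 A0 s0; lra.
exists (pt r) => //; have r0 := rs0 r rrs; have [lr ->] := rat_map_pt r0.
rewrite -wy; apply: wedge_eq0 => //; first exact: unit_neq0.
by rewrite -fE hk (big_rem r)//= /wedge (mulrC r.1) subrr mul0r mulr0.
Qed.

End HomogeneousLift.

(** * Hausdorff measure and Julia sets *)

Section Hausdorff.
Variable R : realType.
Local Notation X := (option R[i]).
Implicit Types (s e : R) (B : set (sphere R)).

Lemma sdist_le_diam (U : set (sphere R)) x y : U x -> U y -> sdist x y <= sdiam U.
Proof.
move=> Ux Uy; apply: ub_le_sup; last by exists x => //; exists y.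
by exists 2 => _ [a _ [b _ <-]]; apply: sdist_le2.
Qed.

Lemma sdiam_ge0 (U : set (sphere R)) : 0 <= sdiam U.
Proof.
have [[x Ux]|/nonemptyPn U0] := pselect (U !=set0).
  by rewrite -(sdist_self x); apply: sdist_le_diam.
rewrite /sdiam (_ : [set _ | _ in _ & _ in _] = set0) ?sup0//.
by rewrite -subset0 => z [a Ua _]; rewrite U0 in Ua.
Qed.

Lemma sdiam_le (U : set (sphere R)) e : 0 <= e ->
  (forall x y, U x -> U y -> sdist x y <= e) -> sdiam U <= e.
Proof.
move=> e0 Ue; have [[x Ux]|/nonemptyPn U0] := pselect (U !=set0).
  apply: ge_sup; first by exists (sdist x x), x => //; exists x.
  by move=> _ [a Ua [b Ub <-]]; apply: Ue.
rewrite /sdiam (_ : [set _ | _ in _ & _ in _] = set0) ?sup0//.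
by rewrite -subset0 => z [a Ua _]; rewrite U0 in Ua.
Qed.

(* Since [0 `^ 0 = 1], every cover has infinite total weight when [s = 0]. *)
Lemma hausdorff_measure0_null s B : 0 <= s -> hausdorff_measure s B = 0%E ->
  0 < s /\ snull (X := X) (@sdist R) s B.
Proof.
move=> s0 hB.
have cov e : 0 < e -> exists U : nat -> set (sphere R), B `<=` \bigcup_i U i /\
    forall n, \sum_(0 <= i < n) sdiam (U i) `^ s <= e.
  move=> e0.
  have : (ereal_inf [set (\sum_(0 <= i <oo) ((sdiam (U i)) `^ s)%:E)%E
      | U in [set U : nat -> set (sphere R) |
               B `<=` \bigcup_i U i /\ forall i, (sdiam (U i) <= 1)%R]] <= 0)%E.
    by rewrite -[leRHS]hB; apply: ereal_sup_ubound; exists 1 => //; apply: ltr01.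
  have e0' : (0 < e%:E)%E by rewrite lte_fin.
  move=> /le_lt_trans/(_ e0')/ereal_inf_lt[_ [U [BU _] <-] Ue]; exists U; split => // n.
  rewrite -lee_fin -sumEFin; apply: le_trans (ltW Ue).
  by apply: nneseries_lim_ge => i _ _; rewrite lee_fin powR_ge0.
split.
  rewrite lt_def s0 andbT; apply/eqP => sE.
  have half0 : 0 < 2^-1 :> R by rewrite invr_gt0.
  have [U [_ /(_ 1%N)]] := cov _ half0.
  by rewrite big_nat1 sE powRr0; lra.
move=> e /cov[U [BU Ue]]; exists U, (fun i => sdiam (U i) `^ s); split => //.
  by move=> i; apply: powR_ge0.
move=> i x y Ux Uy; rewrite ge0_ler_powR ?nnegrE ?sdist_ge0 ?sdiam_ge0//.
exact: sdist_le_diam.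
Qed.

(** For [s > 0] small total weight forces small diameters, so covers of small weight automatically
    meet the mesh constraint [r]. *)
Lemma null_hausdorff_measure0 s B : 0 < s -> snull (X := X) (@sdist R) s B ->
  hausdorff_measure s B = 0%E.
Proof.
move=> s0 nB; apply/eqP; rewrite eq_le; apply/andP; split; last first.
  apply: le_trans (ereal_sup_ubound _); last by exists 1 => //; apply: ltr01.
  apply: le_ereal_inf_tmp => _ [U _ <-].
  by apply: nneseries_ge0 => i _ _; rewrite lee_fin powR_ge0.
apply: ge_ereal_sup => _ [r r0 <-].
apply/lee_addgt0Pr => e e0; rewrite add0e.
have m0 : 0 < Num.min e (r `^ s) by rewrite lt_min e0 powR_gt0.
have [U [w [w0 Uw BU we]]] := nB _ m0.
have wr i : w i <= r `^ s.
  apply: (@le_trans _ _ (Num.min e (r `^ s))); last by rewrite ge_min lexx orbT.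
  by apply: le_trans (we i.+1); rewrite big_nat_recr//= lerDr sumr_ge0.
have dw i : sdiam (U i) <= w i `^ s^-1.
  apply: sdiam_le; first exact: powR_ge0.
  move=> x y Ux Uy; have dx := sdist_ge0 x y.
  have -> : sdist x y = (sdist x y `^ s) `^ s^-1.
    by rewrite -powRrM divff ?powRr1// gt_eqF.
  rewrite ge0_ler_powR ?nnegrE ?powR_ge0 ?invr_ge0 ?(ltW s0)//.
  exact: Uw Ux Uy.
apply: ereal_inf_le; exists (\sum_(0 <= i <oo) ((sdiam (U i)) `^ s)%:E)%E.
  exists U => //; split => // i; apply: le_trans (dw i) _.
  have -> : r = (r `^ s) `^ s^-1 by rewrite -powRrM divff ?powRr1 ?ltW// gt_eqF.
  by rewrite ge0_ler_powR ?nnegrE ?powR_ge0 ?invr_ge0 ?(ltW s0).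
apply: lime_le.
  by apply: is_cvg_nneseries => i _ _; rewrite lee_fin powR_ge0.
apply: nearW => n; rewrite sumEFin lee_fin.
apply: (@le_trans _ _ (\sum_(0 <= i < n) w i)); last first.
  by apply: le_trans (we n) _; rewrite ge_min lexx.
apply: ler_sum => i _.
have -> : w i = (w i `^ s^-1) `^ s by rewrite -powRrM mulVf ?powRr1// gt_eqF.
by rewrite ge0_ler_powR ?nnegrE ?powR_ge0 ?sdiam_ge0// ltW.
Qed.

End Hausdorff.

(** * Closedness and complete invariance of the Julia set *)

Section Julia.
Variables (R : realType) (f : sphere R -> sphere R) (M : R).
Hypothesis M_gt0 : 0 < M.
Hypothesis f_lip : forall x y, sdist (f x) (f y) <= M * sdist x y.

Lemma julia_closed : dclosed (X := option R[i]) (@sdist R) (julia f).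
Proof.
move=> a ha [r r0 hr]; have [y Jy ay] := ha r r0; apply: Jy.
exists (r - sdist a y); first by rewrite subr_gt0.
move=> w yw; apply: hr; have := sdist_tri y a w; lra.
Qed.

(** Equicontinuity near [f x] pulls back to [x] by the Lipschitz bound; the iterate 0 is handled
    separately, whence the minimum with [e]. *)
Lemma julia_image x : julia f x -> julia f (f x).
Proof.
move=> Jx [r r0 hr]; apply: Jx; exists (r / M); first by rewrite divr_gt0.
move=> w xw e e0; have [|eta eta0 h] := hr (f w) _ e e0.
  by apply: le_lt_trans (f_lip _ _) _; rewrite mulrC -ltr_pdivlMr.
exists (Num.min e (eta / M)); first by rewrite lt_min e0 divr_gt0.
move=> [|n] y; rewrite lt_min => /andP[we wy]//.
rewrite /iterate !iterSr; apply: h.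
by apply: le_lt_trans (f_lip _ _) _; rewrite mulrC -ltr_pdivlMr.
Qed.

Hypothesis f_open : forall e, 0 < e -> exists2 eta : R, 0 < eta &
  forall x y', sdist (f x) y' < eta -> exists2 y, sdist x y < e & f y = y'.

(** Openness is used twice: points near [f x] are images of points near [x], and points near such an
    image are images of points near its lift. *)
Lemma julia_preimage x : julia f (f x) -> julia f x.
Proof.
move=> Jx [r r0 hr]; apply: Jx; have [eta eta0 ho] := f_open r0.
exists eta => // w' /ho[w xw <-] e e0; have [t t0 h] := hr w xw e e0.
have [t' t'0 ho'] := f_open t0; exists t' => // n y' /ho'[y wy <-].
by rewrite /iterate -!iterSr; apply: (h n.+1 y).
Qed.

End Julia.

(** * Quadratic conformality, its iterates, and the spherical derivative *)

Section Conformal.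
Variables (R : realType).
Implicit Types (f : sphere R -> sphere R) (x y : sphere R) (A M e : R).

Definition conformal f (D0 : sphere R -> R) A M := [/\ forall x, 0 <= D0 x <= M, 0 <= A &
  forall x y, `|sdist (f x) (f y) - D0 x * sdist x y| <= A * sdist x y ^+ 2].

Lemma conformal_lip f D0 A M x y : conformal f D0 A M ->
  sdist (f x) (f y) <= (M + 2 * A) * sdist x y.
Proof.
move=> [D0M A0 /(_ x y)]; rewrite ler_distl => /andP[_ /le_trans]; apply.
have d0 := sdist_ge0 x y; have d2 := sdist_le2 x y; have /andP[_ DM] := D0M x.
rewrite mulrDl lerD ?ler_wpM2r// expr2 mulrA ler_wpM2r//.
by rewrite mulrC ler_wpM2r.
Qed.

Lemma conformal_iter f D0 A M n : conformal f D0 A M ->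
  exists D' A' M', conformal (iter n f) D' A' M'.
Proof.
move=> fc; have [D0M A0 fA] := fc; elim: n => [|n [D' [A' [M' fc']]]].
  exists (fun=> 1), 0, 1; split=> // [x|x y]; first by rewrite ler01 lexx.
  by rewrite mul1r subrr normr0 mul0r.
have [D'M A'0 fA'] := fc'.
have lip x y : sdist (iter n f x) (iter n f y) <= (M' + 2 * A') * sdist x y.
  exact: conformal_lip fc'.
have M0 : 0 <= M by have /andP[] := D0M None; apply: le_trans.
exists (fun x => D0 (iter n f x) * D' x), (A * (M' + 2 * A') ^+ 2 + M * A'), (M * M').
split.
- move=> x; have /andP[a1 a2] := D0M (iter n f x); have /andP[b1 b2] := D'M x.
  by rewrite mulr_ge0//= ler_pM.
- by apply: addr_ge0; apply: mulr_ge0 => //; apply: sqr_ge0.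
move=> x y; rewrite !iterS; have := fA (iter n f x) (iter n f y); have := fA' x y.
set a := iter n f x; set b := iter n f y; move=> h1 h2.
have -> : sdist (f a) (f b) - D0 a * D' x * sdist x y =
  (sdist (f a) (f b) - D0 a * sdist a b) + D0 a * (sdist a b - D' x * sdist x y) by ring.
apply: le_trans (ler_normD _ _) _; rewrite mulrDl; apply: lerD.
  apply: le_trans h2 _; rewrite -mulrA ler_wpM2l// -exprMn.
  rewrite lerXn2r ?nnegrE ?sdist_ge0 ?lip//.
  by apply: le_trans (lip x y); apply: sdist_ge0.
have /andP[a1 a2] := D0M a.
by rewrite normrM (ger0_norm a1) -mulrA; apply: ler_pM.
Qed.

Lemma sphere_no_isolated x e : 0 < e -> exists2 y, y <> x & sdist y x < e.
Proof.
move=> e0; have [u u1 <-] := pt_unit x.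
pose u' := (- conjc u.2, conjc u.1).
have nconj (z : R[i]) : normc (conjc z) = normc z by case: z => a b /=; rewrite sqrrN.
have u'1 : vnorm u' = 1 by rewrite -u1 /vnorm /u' [_.1]/= [_.2]/= normcN !nconj addrC.
(* [u'] is a unit vector orthogonal to [u]. The bound 1/2 keeps the norm of [v] at least 1/2, and
   [e / 8] then makes the distance at most [e / 2]. *)
pose t : R := Num.min (2^-1) (e / 8).
have t0 : 0 < t by rewrite lt_min invr_gt0 ltr0n divr_gt0.
have t1 : t <= 2^-1 by rewrite ge_min lexx.
have t2 : t <= e / 8 by rewrite ge_min lexx orbT.
pose v := u + vscale (t +i* 0)%C u'.
have nt : normc (t +i* 0)%C = t by rewrite /normc expr0n addr0 sqrtr_sqr gtr0_norm.
have uv : wedge v u = - (t +i* 0)%C.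
  have : (cabs2 u.1 + cabs2 u.2) = 1 by rewrite !cabs2E -vnorm_sqr u1 expr1n.
  rewrite /wedge /v /u' /cabs2; case: (u) => [[a a'] [b b']]; simpc => /= h.
  by apply/eqP; rewrite eq_complex /=; apply/andP; split; apply/eqP;
     [rewrite -[RHS]mulr1 -h; ring|ring].
have wuv : normc (wedge v u) = t by rewrite uv normcN nt.
have v12 : 2^-1 <= vnorm v.
  have := vnorm_dist v u; rewrite /v addrAC subrr add0r vnorm_scale nt u'1 u1.
  by rewrite ler_distl => /andP[+ _]; lra.
have v0 : v != 0 by rewrite -vnorm_gt0; apply: lt_le_trans v12.
exists (pt v).
  move=> vu; have := sdist_pt v0 (unit_neq0 u1); rewrite vu sdist_self wuv u1 mulr1.
  by move=> /esym/eqP; rewrite gt_eqF// divr_gt0 ?mulr_gt0// vnorm_gt0.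
rewrite (sdist_pt v0 (unit_neq0 u1)) wuv u1 mulr1 ltr_pdivrMr ?vnorm_gt0//.
have := ler_wpM2l (ltW e0) v12; lra.
Qed.

(** Both numbers are limits of the same difference quotient at a point that is not isolated. *)
Lemma conformal_deriv f D0 A M x L : conformal f D0 A M -> sph_deriv_norm f x L -> D0 x = L.
Proof.
move=> [_ A0 fA] fL; apply/eqP/negP => /negP DL.
have e0 : 0 < `|D0 x - L| / 2 by rewrite divr_gt0// normr_gt0 subr_eq0.
set e := _ / 2 in e0; have [eta eta0 h] := fL _ e0.
have A1 : 0 < A + 1 by rewrite ltr_wpDl.
have m0 : 0 < Num.min eta (e / (A + 1)) by rewrite lt_min eta0 divr_gt0.
have [y yx] := sphere_no_isolated x m0; rewrite lt_min => /andP[ye yA].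
have d0 : 0 < sdist y x.
  by rewrite lt_def sdist_ge0 andbT; apply/eqP => /sdist_eq0.
have := h y yx ye; have := fA x y; rewrite (sdist_sym x) (sdist_sym (f x)).
set d := sdist y x in d0 yA *; set fd := sdist (f y) (f x).
have -> : fd - D0 x * d = (fd / d - D0 x) * d by field; rewrite gt_eqF.
rewrite normrM (gtr0_norm d0) expr2 mulrA ler_pM2r// => h1 h2.
have h3 : A * d < e.
  rewrite ltr_pdivlMr// in yA; apply: le_lt_trans yA; rewrite mulrC.
  by rewrite ler_wpM2l ?lerDl// ltW.
have := ler_distD (fd / d) (D0 x) L; rewrite (distrC (D0 x) (fd / d)).
have : `|D0 x - L| = 2 * e by rewrite /e; field.
by lra.
Qed.

Lemma open_iter f n : (forall e, 0 < e -> exists2 eta : R, 0 < eta &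
    forall x y', sdist (f x) y' < eta -> exists2 y, sdist x y < e & f y = y') ->
  forall e, 0 < e -> exists2 eta : R, 0 < eta &
    forall x y', sdist (iter n f x) y' < eta -> exists2 y, sdist x y < e & iter n f y = y'.
Proof.
move=> fo; elim: n => [|n IH] e e0; first by exists e => // x y' xy; exists y'.
have [t t0 ht] := IH e e0; have [eta eta0 h] := fo t t0; exists eta => // x y'.
by move=> /h[y1 /ht[y xy yy1] fy1]; exists y; rewrite //= yy1.
Qed.

End Conformal.

(** * Application to expanding rational maps *)

Lemma bad_null_julia_null (R : realType) (p q : {poly R[i]}) (z0 : sphere R) (s s' : R) :
  coprimep p q -> (2 <= rat_degree p q)%N -> expanding (rat_map p q) ->
  julia (rat_map p q) z0 -> 0 < s -> s < s' ->
  snull (X := option R[i]) (@sdist R) s (bad_set (rat_map p q) z0) ->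
  snull (X := option R[i]) (@sdist R) s' (julia (rat_map p q)).
Proof.
move=> pq deg2 [C0 [lam [C00 lam1 texp]]] Jz0 s0 ss' nB.
have D1 : (0 < rat_degree p q)%N by apply: leq_trans deg2.
set T := rat_map p q in texp Jz0 nB *.
have [D0 [A [M fc]]] : exists D0 A M, conformal T D0 A M := rat_map_conformal pq D1.
have [D0M A0 fA] := fc.
have lipT x y : sdist (T x) (T y) <= (M + 2 * A + 1) * sdist x y.
  apply: le_trans (conformal_lip x y fc) _; rewrite ler_wpM2r ?sdist_ge0//; lra.
have M0 : 0 <= M by have /andP[] := D0M z0; apply: le_trans.
set Mt := M + 2 * A + 1 in lipT.
have Mt1 : 1 <= Mt by rewrite /Mt; lra.
have Mt0 : 0 < Mt by lra.
(* Expansion at [z0] shows that [T] is not constant: with positive derivative [L], a nearby [y] with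
   [T y = T z0] would give [L d <= A d^2 < L d]. *)
have [x1 [x2 x12]] : exists x1 x2, T x1 != T x2.
  have [L [Ld Lge]] := texp 1%N z0 isT Jz0.
  have DL : D0 z0 = L by apply: (conformal_deriv fc).
  have L0 : 0 < L by apply: lt_le_trans Lge; rewrite mulr_gt0// exprn_gt0//; lra.
  have A1 : 0 < A + 1 by lra.
  have [y yz] := sphere_no_isolated z0 (divr_gt0 L0 A1).
  rewrite ltr_pdivlMr// => yA; exists z0, y; apply/eqP => Tzy.
  have d0 : 0 < sdist z0 y.
    by rewrite lt_def sdist_ge0 andbT; apply/eqP => /sdist_eq0/esym.
  have := fA z0 y; rewrite Tzy sdist_self DL sub0r normrN ger0_norm ?mulr_ge0 ?(ltW L0) ?(ltW d0)//.
  rewrite expr2 mulrA ler_pM2r//; rewrite sdist_sym in yA.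
  by have := ltW d0; nra.
have Topen e : 0 < e -> exists2 eta : R, 0 < eta &
    forall x y', sdist (T x) y' < eta -> exists2 y, sdist x y < e & T y = y'.
  by move=> e0; apply: (rat_map_open pq D1 x12 e0).
have [N N0 hN] : exists2 N, (0 < N)%N & 8 <= C0 * lam ^+ N.
  have lam0 : 0 < lam by lra.
  have [|||m hm] := @geometric_small R lam^-1 (C0 / 8).
  - by rewrite invr_ge0 ltW.
  - by rewrite invf_lt1.
  - by rewrite divr_gt0.
  exists m.+1 => //; have lm0 : 0 < lam ^+ m by rewrite exprn_gt0.
  have h : 8 <= C0 * lam ^+ m.
    move: hm; rewrite exprVn -[_^-1]div1r ltr_pdivrMr// mulrAC ltr_pdivlMr//; lra.
  by apply: le_trans h _; rewrite ler_pM2l// exprS ler_peMl// ltW.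
pose S := iter N T.
have [D' [A' [M' Sc]]] := conformal_iter N fc; have [D'M A'0 SA] := Sc.
have D8 x : julia T x -> 8 <= D' x.
  move=> Jx; have [L [Ld Lge]] := texp N x N0 Jx.
  by rewrite (conformal_deriv Sc Ld); apply: le_trans Lge.
have lipS x y : sdist (S x) (S y) <= (M' + 2 * A' + 1) * sdist x y.
  apply: le_trans (conformal_lip x y Sc) _; rewrite ler_wpM2r ?sdist_ge0//; lra.
have M'0 : 0 <= M' by have /andP[] := D'M z0; apply: le_trans.
have iterJ n x : julia T x -> julia T (iter n T x).
  by move=> Jx; elim: n => //= n; apply: (julia_image Mt0 lipT).
have iterJi n x : julia T (iter n T x) -> julia T x.
  by elim: n => //= n IH /(julia_preimage Topen)/IH.
have iterlip n x y : sdist (iter n T x) (iter n T y) <= Mt ^+ n * sdist x y.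
  elim: n => [|n IH]; first by rewrite mul1r.
  by apply: le_trans (lipT _ _) _; rewrite exprS -mulrA ler_wpM2l// ltW.
have A'1 : 0 < A' + 1 by lra.
pose r0 := (A' + 1)^-1; have r00 : 0 < r0 by rewrite invr_gt0.
have [eta eta0 heta] := open_iter N Topen r00.
pose rho := Num.min (r0 / 4) (eta / 2).
have rho0 : 0 < rho by rewrite lt_min !divr_gt0.
have rho4 : rho <= r0 / 4 by rewrite ge_min lexx.
have rhoeta : rho <= eta / 2 by rewrite ge_min lexx orbT.
apply: (@repeller_null R (option R[i]) (@sdist R) (@sdist_ge0 R) (@sdist_self R)
  (@sdist_eq0 R) (@sdist_sym R) (@sdist_tri R) (@sdist_cluster R) (julia T) S D' A'
  (M' + 2 * A' + 1) r0 rho _ _ _ SA _ lipS D8 A'0 r00 _ rho0 _ _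
  (fun k => iter k T z0) N (bad_set T z0) s s' s0 ss' _ nB).
- exact: julia_closed.
- exact: iterJ.
- exact: iterJi.
- lra.
- by rewrite /r0 -[_^-1]div1r mulrCA mul1r ler_pdivrMr// mul1r lerDl.
- lra.
- move=> x y' xy'; have [|y xy Sy] := heta x y'; first by apply: le_lt_trans xy' _; lra.
  by exists y => //; apply: ltW.
(* Absorption: if [T^j z] came close to [z0], applying [T] up to the next multiple of [n * N] would
   bring a forbidden point close to a point of [L]. *)
move=> L n c n0 c0 LJ Ln Lc z Lz; split; first exact: LJ.
have P0 : (0 < n * N)%N by rewrite muln_gt0 n0.
have LP m : L (iter (m * (n * N)) T z).
  elim: m => [|m IH]; first by [].
  by rewrite mulSn iterD iterM; apply: Ln.
(* At most [n * N] further applications of [T] are made, each stretching distances by at most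
   [Mt]. *)
exists (c / Mt ^+ (n * N)); first by rewrite divr_gt0// exprn_gt0.
move=> j; rewrite /sball/= => zj.
pose m := (j %/ (n * N))%N; pose j' := (j %% (n * N))%N.
have j'P : (j' < n * N)%N by apply: ltn_pmod.
have jE : iterate T j z = iter j' T (iter (m * (n * N)) T z).
  by rewrite /iterate {1}(divn_eq j (n * N)) addnC iterD.
rewrite jE in zj; set zm := iter (m * _) T z in zj.
have := iterlip (n * N - j')%N z0 (iter j' T zm).
rewrite -iterD subnK; last exact: ltnW.
have Lzm : L (iter (n * N) T zm) by rewrite iterM; apply: Ln; apply: LP.
have kP : (0 < n * N - j' <= n * N)%N by rewrite subn_gt0 j'P leq_subr.
move=> h; have := le_trans (Lc _ _ Lzm kP) h; apply/negP; rewrite -ltNge.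
move: zj; rewrite ltr_pdivlMr ?exprn_gt0// mulrC; apply: le_lt_trans.
by rewrite ler_wpM2r ?sdist_ge0// ler_weXn2l// leq_subr.
Qed.

Theorem theorem8 (R : realType) (p q : {poly R[i]}) (z0 : sphere R) :
  coprimep p q ->
  (2 <= rat_degree p q)%N ->
  expanding (rat_map p q) ->
  julia (rat_map p q) z0 ->
  hausdorff_dim (bad_set (rat_map p q) z0) = hausdorff_dim (julia (rat_map p q)).
Proof.
move=> pq deg2 Texp Jz0; apply/eqP; rewrite eq_le; apply/andP; split.
  apply: ereal_inf_le_tmp => _ [s [s0 hs] <-]; exists s => //; split => //.
  have [s1 nJ] := hausdorff_measure0_null s0 hs.
  by apply: null_hausdorff_measure0 => //; apply: snullW nJ => x [].
apply: le_ereal_inf_tmp => _ [s [s0 hs] <-].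
have [s1 nB] := hausdorff_measure0_null s0 hs.
(* Nullity of the Julia set is obtained only for exponents strictly above [s], hence the slack
   [e]. *)
apply/lee_addgt0Pr => e e0; apply: ereal_inf_lbound.
exists (s + e); last by rewrite EFinD.
have se : s < s + e by rewrite ltrDl.
split; first by rewrite ltW// addr_gt0.
apply: null_hausdorff_measure0; first by rewrite addr_gt0.
exact: bad_null_julia_null pq deg2 Texp Jz0 s1 se nB.
Qed.
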